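(* Let $(X_0,X_1)$ and $(Y_0,Y_1)$ be compatible pairs of quasi-Banach lattices such that $Y_0$ and $Y_1$ have the $K_{\infty,1}$ property. Then for every linear operator of pairs $T:(X_0,X_1)\to(Y_0,Y_1)$ and every function $\varphi\in\mathcal P$, $T$ maps $\varphi^c(X_0,X_1)$ boundedly into $\varphi^c(Y_0,Y_1)$.
   Context: All spaces are real. A quasi-norm satisfies the norm axioms except that the triangle inequality is replaced by $\|x+y\|\le C(\|x\|+\|y\|)$ for some constant $C\ge1$. A quasi-Banach lattice is a vector lattice with a complete quasi-norm such that $\|x\|\le\|y\|$ whenever $|x|\le|y|$. Compatible pair: $(X_0,X_1)$ is a compatible pair of quasi-Banach lattices if there are a Hausdorff locally solid topological vector lattice $X$ and injective, continuous, interval preserving lattice homomorphisms $j_i:X_i\hookrightarrow X$ ($i=0,1$), where interval preserving means $j_i([0,x])=[0,j_i(x)]$ for $x\ge0$. One identifies $X_i$ with its image. Then $X_0+X_1=\{x_0+x_1: x_i\in X_i\}\subset X$ is a quasi-Banach lattice with quasi-norm $\|x\|=\inf\{\|x_0\|_{X_0}+\|x_1\|_{X_1}:x=x_0+x_1\}$, containing $X_0,X_1$ as (not necessarily closed) ideals. A linear operator of pairs $T:(X_0,X_1)\to(Y_0,Y_1)$ is a bounded linear map $T:X_0+X_1\to Y_0+Y_1$ such that $T|_{X_i}$ maps $X_i$ boundedly into $Y_i$ for $i=0,1$. The class $\mathcal P$: all functions $\varphi:(0,\infty)\times(0,\infty)\to[0,\infty)$ with $\varphi(\lambda s,\lambda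 t)=\lambda\varphi(s,t)$ for $s,t,\lambda>0$ and non-decreasing in each variable, normalized by $\varphi(1,1)=1$. Such $\varphi$ extends uniquely to a continuous function on $[0,\infty)^2$, still denoted $\varphi$. Functional calculus: for positive $x_0,x_1$ in a quasi-Banach lattice, $\varphi(x_0,x_1)$ is defined by Krivine's functional calculus; concretely, the (non-closed) ideal generated by $e=x_0\vee x_1$ is lattice isomorphic to some $C(\Omega)$, $\Omega$ compact Hausdorff, with $e$ corresponding to $1_\Omega$, and $\varphi(x_0,x_1)$ corresponds to the function $\omega\mapsto\varphi(\hat x_0(\omega),\hat x_1(\omega))$. Calderón–Lozanovskii space: $\varphi(X_0,X_1)=\{x\in X_0+X_1:|x|\le\varphi(x_0,x_1)\text{ for some }x_0\in X_0^+,x_1\in X_1^+\}$, a quasi-Banach lattice with quasi-norm $\|x\|_{\varphi(X_0,X_1)}=\inf\{\lambda>0:|x|\le\lambda\varphi(x_0,x_1),\ x_i\in X_i^+,\ \|x_0\|_{X_0}\le1,\ \|x_1\|_{X_1}\le1\}$. $\varphi^c(X_0,X_1)$ is the Gagliardo completion of $\varphi(X_0,X_1)$ in $X_0+X_1$: the quasi-normed space whose unit ball is the closure in $X_0+X_1$ of the unit ball of $\varphi(X_0,X_1)$. A linear operator $T:E\to F$ between quasi-Banach lattices is $(\infty,1)$-regular if there is $K>0$ with $\big\|\bigvee_{i=1}^n|Tx_i|\big\|\le K\big\|\sum_{i=1}^n|x_i|\big\|$ for all finite families $(x_i)_{i=1}^n\subset E$; $\rho_{\infty,1}(T)$ denotes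 the smallest such $K$. A quasi-Banach lattice $F$ has the $K_{\infty,1}$ property if there is a constant $C>0$ such that for every quasi-Banach lattice $E$, every bounded linear operator $T:E\to F$ is $(\infty,1)$-regular with $\rho_{\infty,1}(T)\le C\|T\|$. *)

(* Defs.v *)
From HB Require Import structures.
From mathcomp Require Import all_boot all_order all_algebra.
From mathcomp Require Import all_classical all_reals all_analysis.

Set Implicit Arguments.
Unset Strict Implicit.
Unset Printing Implicit Defensive.

Import Order.TTheory GRing.Theory Num.Theory.
Import numFieldNormedType.Exports.

Local Open Scope classical_set_scope.
Local Open Scope ring_scope.

(** * Vector lattices *)

(** [Order.Lattice] cannot be used here: HB requires its joins with the additive
    structures to be declared before [Num.POrderedZmodule]. The order is the
    library's, and [vjoin], [vmeet] are the suprema and infima of pairs. *)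
HB.mixin Record POrderedLmodule_isVectorLattice (R : realType) V
    of GRing.Lmodule R V & Num.POrderedZmodule V := {
  vlattice_lerD2r : forall z x y : V, x <= y -> x + z <= y + z ;
  vlattice_scaler_ge0 : forall (a : R) (x : V), 0 <= a -> 0 <= x -> 0 <= a *: x ;
  vjoin : V -> V -> V ;
  vmeet : V -> V -> V ;
  vjoin_le : forall x y z : V, (vjoin x y <= z) = (x <= z) && (y <= z) ;
  le_vmeet : forall x y z : V, (z <= vmeet x y) = (z <= x) && (z <= y)
}.

#[short(type="vectorLatticeType")]
HB.structure Definition VectorLattice (R : realType) :=
  {V of GRing.Lmodule R V & Num.POrderedZmodule V &
        POrderedLmodule_isVectorLattice R V}.

Definition vabs (R : realType) (V : vectorLatticeType R) (x : V) : V :=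
  vjoin x (- x).

Definition lattice_hom (R : realType) (V W : vectorLatticeType R)
    (j : V -> W) : Prop :=
  forall x y, j (vjoin x y) = vjoin (j x) (j y) /\
              j (vmeet x y) = vmeet (j x) (j y).

Definition interval_preserving (R : realType) (V W : vectorLatticeType R)
    (j : V -> W) : Prop :=
  forall x, 0 <= x ->
    j @` [set u | 0 <= u <= x] = [set w | 0 <= w <= j x].

Definition solid (R : realType) (V : vectorLatticeType R) (A : set V) : Prop :=
  forall x y, A y -> vabs x <= vabs y -> A x.

(** The (not necessarily closed) ideal generated by a positive element [e]. *)
Definition principal_ideal (R : realType) (V : vectorLatticeType R) (e : V)
    : set V :=
  [set x | exists a : R, vabs x <= a *: e].

#[short(type="topVectorLatticeType")]
HB.structure Definition TopVectorLattice (R : realType) :=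
  {V of TopologicalLmodule R V & VectorLattice R V}.

Definition locally_solid (R : realType) (V : topVectorLatticeType R) : Prop :=
  forall U : set V, nbhs (0 : V) U ->
    exists S : set V, [/\ nbhs (0 : V) S, solid S & S `<=` U].

(** * Quasi-norms *)

(** Neighbourhoods of [x] for the topology of a quasi-norm [N]. Quasi-balls
    need not be open, but they do form a neighbourhood base. *)
Definition qnorm_nbhs (R : realType) (V : lmodType R) (N : V -> R) (x : V)
    : set_system V :=
  filter_from [set e : R | 0 < e] (fun e => [set y | N (y - x) < e]).

Definition qnorm_closure (R : realType) (V : lmodType R) (N : V -> R)
    (A : set V) : set V :=
  [set x | forall B, qnorm_nbhs N x B -> A `&` B !=set0].

Definition qnorm_cauchy (R : realType) (V : lmodType R) (N : V -> R)
    (u : nat -> V) : Prop :=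
  forall e : R, 0 < e -> exists n0 : nat, forall m n : nat,
    (n0 <= m)%N -> (n0 <= n)%N -> N (u m - u n) < e.

HB.mixin Record VectorLattice_isQuasiBanach (R : realType) V
    of VectorLattice R V := {
  qnorm : V -> R ;
  qnorm_ge0 : forall x, 0 <= qnorm x ;
  qnorm_eq0 : forall x, qnorm x = 0 -> x = 0 ;
  qnormZ : forall (a : R) x, qnorm (a *: x) = `|a| * qnorm x ;
  qnormD : exists2 C : R, 1 <= C &
    forall x y, qnorm (x + y) <= C * (qnorm x + qnorm y) ;
  qnorm_monotone : forall x y, vabs x <= vabs y -> qnorm x <= qnorm y ;
  qnorm_complete : forall u : nat -> V, qnorm_cauchy qnorm u ->
    exists l : V, u @ \oo --> qnorm_nbhs qnorm l
}.

#[short(type="quasiBanachLatticeType")]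
HB.structure Definition QuasiBanachLattice (R : realType) :=
  {V of VectorLattice R V & VectorLattice_isQuasiBanach R V}.

Definition maps_boundedly (R : realType) (V W : lmodType R) (T : V -> W)
    (E : set V) (NE : V -> R) (F : set W) (NF : W -> R) : Prop :=
  exists M : R, forall x, E x -> F (T x) /\ NF (T x) <= M * NE x.

(** * (oo,1)-regular operators *)

Section Regular.
Variables (R : realType) (E F : quasiBanachLatticeType R).

Definition bounded_op (T : E -> F) : Prop :=
  maps_boundedly T setT (@qnorm R E) setT (@qnorm R F).

Definition opnorm (T : E -> F) : R :=
  sup [set qnorm (T x) | x in [set x : E | qnorm x <= 1]].

(** All the [vabs (T (x i))] are positive, so starting the join at [0] does not
    change its value when [n > 0]. *)
Definition regular_bound (T : E -> F) (K : R) : Prop :=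
  forall (n : nat) (x : 'I_n -> E),
    qnorm (\big[vjoin/0]_(i < n) vabs (T (x i)))
      <= K * qnorm (\sum_(i < n) vabs (x i)).

Definition regular_oo1 (T : E -> F) : Prop :=
  exists2 K : R, 0 < K & regular_bound T K.

(** An infimum, since for [T = 0] there is no least positive bound. *)
Definition rho_oo1 (T : E -> F) : R :=
  inf [set K : R | 0 < K /\ regular_bound T K].

End Regular.

Definition K_oo1_property (R : realType) (F : quasiBanachLatticeType R)
    : Prop :=
  exists2 C : R, 0 < C &
    forall (E : quasiBanachLatticeType R) (T : {linear E -> F}),
      bounded_op T -> regular_oo1 T /\ rho_oo1 T <= C * opnorm T.

(** * Compatible pairs and their sum *)

Definition compatible_embedding (R : realType) (E : quasiBanachLatticeType R)
    (V : topVectorLatticeType R) (j : E -> V) : Prop :=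
  [/\ injective j,
      forall x, j @ qnorm_nbhs (@qnorm R E) x --> j x,
      interval_preserving j
    & lattice_hom j].

Record compatiblePair (R : realType) := CompatiblePair {
  cp0 : quasiBanachLatticeType R ;
  cp1 : quasiBanachLatticeType R ;
  cp_ambient : topVectorLatticeType R ;
  cp_hausdorff : hausdorff_space cp_ambient ;
  cp_locally_solid : locally_solid cp_ambient ;
  cp_emb0 : {linear cp0 -> cp_ambient} ;
  cp_emb1 : {linear cp1 -> cp_ambient} ;
  cp_emb0P : compatible_embedding cp_emb0 ;
  cp_emb1P : compatible_embedding cp_emb1
}.

Section Sum.
Variables (R : realType) (X : compatiblePair R).

Definition sum_pred : {pred cp_ambient X} := fun x =>
  `[< exists x0 x1, x = cp_emb0 X x0 + cp_emb1 X x1 >].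

Lemma sum_submod_closed : submod_closed sum_pred.
Proof.
split.
  by apply/asboolP; exists 0, 0; rewrite !linear0 addr0.
move=> a x y /asboolP[x0 [x1 ->]] /asboolP[y0 [y1 ->]]; apply/asboolP.
exists (a *: x0 + y0), (a *: x1 + y1).
by rewrite !linearP/= scalerDr addrACA.
Qed.

HB.instance Definition _ :=
  GRing.isSubmodClosed.Build R (cp_ambient X) sum_pred sum_submod_closed.

Record pairSum := PairSum {
  sum_val :> cp_ambient X ;
  sum_valP : sum_val \in sum_pred
}.

HB.instance Definition _ := [isSub for sum_val].
HB.instance Definition _ := [Choice of pairSum by <:].
HB.instance Definition _ := [SubChoice_isSubLmodule of pairSum by <:].

Lemma sum_emb0_subproof (x : cp0 X) : cp_emb0 X x \in sum_pred.
Proof. by apply/asboolP; exists x, 0; rewrite linear0 addr0. Qed.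

Lemma sum_emb1_subproof (x : cp1 X) : cp_emb1 X x \in sum_pred.
Proof. by apply/asboolP; exists 0, x; rewrite linear0 add0r. Qed.

Definition sum_emb0 (x : cp0 X) : pairSum := PairSum (sum_emb0_subproof x).
Definition sum_emb1 (x : cp1 X) : pairSum := PairSum (sum_emb1_subproof x).

Definition sum_qnorm (x : pairSum) : R :=
  inf [set r | exists x0 x1,
    x = sum_emb0 x0 + sum_emb1 x1 /\ r = qnorm x0 + qnorm x1].

End Sum.

Record operator_of_pairs (R : realType) (X Y : compatiblePair R)
    (T : pairSum X -> pairSum Y) : Prop := OperatorOfPairs {
  op_bounded : maps_boundedly T setT (@sum_qnorm R X) setT (@sum_qnorm R Y) ;
  op_bounded0 : exists M : R, forall x : cp0 X, exists2 y : cp0 Y,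
    T (sum_emb0 x) = sum_emb0 y & qnorm y <= M * qnorm x ;
  op_bounded1 : exists M : R, forall x : cp1 X, exists2 y : cp1 Y,
    T (sum_emb1 x) = sum_emb1 y & qnorm y <= M * qnorm x
}.

(** * The class P and the functional calculus *)

(** Only the values of [phi] on pairs of positive reals are meaningful. *)
Record classP (R : realType) (phi : R -> R -> R) : Prop := ClassP {
  classP_ge0 : forall s t, 0 < s -> 0 < t -> 0 <= phi s t ;
  classP_homogeneous : forall l s t, 0 < l -> 0 < s -> 0 < t ->
    phi (l * s) (l * t) = l * phi s t ;
  classP_monotone1 : forall s s' t, 0 < s -> 0 < t -> s <= s' ->
    phi s t <= phi s' t ;
  classP_monotone2 : forall s t t', 0 < s -> 0 < t -> t <= t' ->
    phi s t <= phi s t' ;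
  classP_normalized : phi 1 1 = 1
}.

(** [psi] is the continuous extension of [phi] to the closed quadrant. *)
Definition quadrant_extension (R : realType) (phi psi : R -> R -> R) : Prop :=
  {within [set p : R * R | 0 <= p.1 /\ 0 <= p.2],
     continuous (fun p : R * R => psi p.1 p.2)} /\
  (forall s t, 0 < s -> 0 < t -> psi s t = phi s t).

(** [h], restricted to the ideal generated by [e], is a lattice isomorphism
    onto C(Omega) sending [e] to the constant function 1. *)
Definition order_unit_representation (R : realType) (V : vectorLatticeType R)
    (e : V) (Omega : topologicalType) (h : V -> Omega -> R) : Prop :=
  let I := principal_ideal e in
  [/\ set_bij I [set f : Omega -> R | continuous f] h,
      forall (a : R) x y, I x -> I y ->
        forall w, h (a *: x + y) w = a * h x w + h y w,
      forall x y, I x -> I y -> forall w,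
        h (vjoin x y) w = Num.max (h x w) (h y w) /\
        h (vmeet x y) w = Num.min (h x w) (h y w)
    & forall w, h e w = 1].

(** [functional_calculus phi x0 x1 z] means z = phi(x0, x1), for positive
    [x0], [x1]. As the representation is unique up to a homeomorphism of Omega,
    there is at most one such [z]. When [x0 = x1 = 0], Omega is empty. *)
Definition functional_calculus (R : realType) (V : vectorLatticeType R)
    (phi : R -> R -> R) (x0 x1 z : V) : Prop :=
  let e := vjoin x0 x1 in
  exists (psi : R -> R -> R) (Omega : topologicalType) (h : V -> Omega -> R),
    [/\ quadrant_extension phi psi,
        compact [set: Omega] /\ hausdorff_space Omega,
        order_unit_representation e h,
        principal_ideal e z
      & forall w, h z w = psi (h x0 w) (h x1 w)].

(** * Calderon-Lozanovskii spaces and Gagliardo completions *)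

Section CalderonLozanovskii.
Variables (R : realType) (X : compatiblePair R) (phi : R -> R -> R).

(** X0 + X1 is an ideal of the ambient lattice, so absolute values, principal
    ideals and phi(x0, x1) are the same in both. *)
Definition CL_space : set (pairSum X) :=
  [set x | exists (x0 : cp0 X) (x1 : cp1 X) (z : cp_ambient X),
    [/\ 0 <= x0, 0 <= x1,
        functional_calculus phi (cp_emb0 X x0) (cp_emb1 X x1) z
      & vabs (sum_val x) <= z]].

Definition CL_qnorm (x : pairSum X) : R :=
  inf [set l : R | 0 < l /\
    exists (x0 : cp0 X) (x1 : cp1 X) (z : cp_ambient X),
    [/\ 0 <= x0 /\ qnorm x0 <= 1, 0 <= x1 /\ qnorm x1 <= 1,
        functional_calculus phi (cp_emb0 X x0) (cp_emb1 X x1) z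
      & vabs (sum_val x) <= l *: z]].

Definition CLc_ball : set (pairSum X) :=
  qnorm_closure (@sum_qnorm R X) [set x | CL_space x /\ CL_qnorm x <= 1].

(** The quasi-normed space with unit ball [CLc_ball]: the span of the ball,
    with its Minkowski functional. *)
Definition CLc_space : set (pairSum X) :=
  [set x | exists2 l : R, 0 < l & CLc_ball (l^-1 *: x)].

Definition CLc_qnorm (x : pairSum X) : R :=
  inf [set l : R | 0 < l /\ CLc_ball (l^-1 *: x)].

End CalderonLozanovskii.

(* Main.v *)
Require Import Defs.
From HB Require Import structures.
From mathcomp Require Import all_boot all_order all_algebra.
From mathcomp Require Import all_classical all_reals all_analysis.
From mathcomp Require Import ring lra.

Set Implicit Arguments.
Unset Strict Implicit.
Unset Printing Implicit Defensive.

Import Order.TTheory GRing.Theory Num.Theory.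
Import numFieldNormedType.Exports.

Local Open Scope classical_set_scope.
Local Open Scope ring_scope.

(** Let [|x| <= phi(x0, x1)]. In the C(Omega) representation of the ideal of
    [x0 \/ x1], cut [x] into pieces [u_k] supported where [x1/x0] lies in
    consecutive intervals chosen so that the weights [alpha_k], [beta_k] with
    [|u_k| <= min (alpha_k x0) (beta_k x1)] (up to a constant) respectively at
    least double and at least halve from one piece to the next. Regularity of
    [T] on each space of the pair yields majorants [y0], [y1] of all
    [T u_k / alpha_k], [T u_k / beta_k], and because the weights are geometric,
    [sum_k |T u_k| <= sum_k min (alpha_k y0) (beta_k y1)] is at most a multiple
    of [phi(y0, y1)]. There remain two extreme pieces, where [x1/x0] is close to
    0 or to infinity; one of them satisfies [|u| <= (phi(1, 0) + eta) x0], so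
    [T u] is within [O(eta)] of something bounded by [phi(1, 0) y0], and this is
    why the Gagliardo completion appears. On the side of [Y], phi(y0, y1) exists
    by Kakutani's theorem, the order unit norm being complete because [Y0] and
    [Y1] are.

    Kakutani's theorem is obtained from functionals [p] that are monotone,
    sublinear, maxitive and satisfy [p (x + a e) = p x + a] (suprema over
    closed sets of characters): the minimal ones are the lattice
    homomorphisms, by Zorn there are enough of them, and a lattice version of
    the Stone-Weierstrass theorem concludes. *)

(** * Vector lattices *)

(** Regularity speaks of finite families, so the cut is finite, and this is what leaves the two
    extreme pieces over. The number of pieces grows as [eta] tends to 0, and in a quasi-norm adding
    the [T u_k] one at a time would cost a factor growing with it. So the middle pieces are never
    added in quasi-norm on the side of [Y]: each space only sees a join, controlled by the sum of
    the [|u_k| / alpha_k], which is at most a fixed multiple of [x0] because the cut is a partition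
    of unity. The addition takes place in the order, under phi. The final constant is [10 * D]: [D]
    depends on [T] and the spaces but not on [x] or [eta], and 10 = 1 + 1 + 8 counts the two extreme
    pieces and the geometric sum. On an extreme piece the excess [eta] over phi(1, 0) cannot in
    general be dominated by phi(y0, y1), for instance when phi(1, 0) = 0; it is thrown away as an
    error in the sum space. *)

Section VectorLatticeTheory.
Variables (R : realType) (V : vectorLatticeType R).
Implicit Types (x y z u v e : V) (a b c : R).

Lemma vlerD2r z x y : (x + z <= y + z) = (x <= y).
Proof.
apply/idP/idP; last exact: vlattice_lerD2r.
by move=> /(vlattice_lerD2r (- z)); rewrite !addrK.
Qed.

Lemma vlerD2l z x y : (z + x <= z + y) = (x <= y).
Proof. by rewrite ![z + _]addrC vlerD2r. Qed.

Lemma vlerD x y u v : x <= y -> u <= v -> x + u <= y + v.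
Proof.
by move=> xy uv; apply: (@le_trans _ _ (y + u)); rewrite ?vlerD2r ?vlerD2l.
Qed.

Lemma vsubr_ge0 x y : (0 <= y - x) = (x <= y).
Proof. by rewrite -(vlerD2r x 0) add0r subrK. Qed.

Lemma vlerN2 x y : (- x <= - y) = (y <= x).
Proof. by rewrite -(vlerD2r (x + y) (- x)) addrA addNr add0r addrC addrK. Qed.

Lemma vlerBlDr x y z : (x - y <= z) = (x <= z + y).
Proof. by rewrite -(vlerD2r y (x - y)) subrK. Qed.

Lemma vlerBrDr x y z : (x <= y - z) = (x + z <= y).
Proof. by rewrite -(vlerD2r z x) subrK. Qed.

Lemma vaddr_ge0 x y : 0 <= x -> 0 <= y -> 0 <= x + y.
Proof. by move=> x0 y0; rewrite -(addr0 0); exact: vlerD. Qed.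

Lemma vsumr_ge0 n (f : 'I_n -> V) : (forall i, 0 <= f i) -> 0 <= \sum_i f i.
Proof. by move=> f0; elim/big_ind: _ => // x y; exact: vaddr_ge0. Qed.

Lemma vler_sum n (f g : 'I_n -> V) :
  (forall i, f i <= g i) -> \sum_i f i <= \sum_i g i.
Proof. by move=> fg; elim/big_ind2: _ => // *; exact: vlerD. Qed.

Lemma vlerZl a x y : 0 <= a -> x <= y -> a *: x <= a *: y.
Proof.
move=> a0; rewrite -vsubr_ge0 => xy; rewrite -vsubr_ge0 -scalerBr.
exact: vlattice_scaler_ge0.
Qed.

Lemma vlerZr a b x : 0 <= x -> a <= b -> a *: x <= b *: x.
Proof.
move=> x0 ab; rewrite -vsubr_ge0 -scalerBl.
by apply: vlattice_scaler_ge0 => //; rewrite subr_ge0.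
Qed.

Lemma vlerZ_pos c x y : 0 < c -> (c *: x <= c *: y) = (x <= y).
Proof.
move=> c0; apply/idP/idP; last exact/vlerZl/ltW.
have ci : 0 <= c^-1 by rewrite invr_ge0 ltW.
by move=> /(vlerZl ci); rewrite !scalerA mulVf ?gt_eqF// !scale1r.
Qed.

Lemma vjoin_lel x y : x <= vjoin x y.
Proof. by have := vjoin_le x y (vjoin x y); rewrite lexx => /esym/andP[]. Qed.

Lemma vjoin_ler x y : y <= vjoin x y.
Proof. by have := vjoin_le x y (vjoin x y); rewrite lexx => /esym/andP[]. Qed.

Lemma vjoin_lub x y z : x <= z -> y <= z -> vjoin x y <= z.
Proof. by rewrite vjoin_le => -> ->. Qed.

Lemma vmeet_lel x y : vmeet x y <= x.
Proof. by have := le_vmeet x y (vmeet x y); rewrite lexx => /esym/andP[]. Qed.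

Lemma vmeet_ler x y : vmeet x y <= y.
Proof. by have := le_vmeet x y (vmeet x y); rewrite lexx => /esym/andP[]. Qed.

Lemma vmeet_glb x y z : z <= x -> z <= y -> z <= vmeet x y.
Proof. by rewrite le_vmeet => -> ->. Qed.

Lemma vjoin_eqr x y : (vjoin x y == y) = (x <= y).
Proof.
apply/eqP/idP => [<-|xy]; first exact: vjoin_lel.
by apply: le_anti; rewrite vjoin_ler andbT vjoin_lub.
Qed.

Lemma vmeetE x y : vmeet x y = - vjoin (- x) (- y).
Proof.
apply: le_anti; apply/andP; split.
  by rewrite -[leLHS]opprK vlerN2 vjoin_lub// vlerN2 ?vmeet_lel ?vmeet_ler.
by apply: vmeet_glb; rewrite -[leRHS]opprK vlerN2 ?vjoin_lel ?vjoin_ler.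
Qed.

Lemma vjoinD x y z : vjoin (x + z) (y + z) = vjoin x y + z.
Proof.
apply: le_anti; apply/andP; split.
  by apply: vjoin_lub; rewrite vlerD2r ?vjoin_lel ?vjoin_ler.
by rewrite -vlerBrDr vjoin_lub// vlerBrDr ?vjoin_lel ?vjoin_ler.
Qed.

Lemma vjoinZ c x y : 0 < c -> vjoin (c *: x) (c *: y) = c *: vjoin x y.
Proof.
move=> c0; have ci : 0 < c^-1 by rewrite invr_gt0.
apply: le_anti; apply/andP; split.
  by apply: vjoin_lub; rewrite vlerZ_pos// ?vjoin_lel ?vjoin_ler.
rewrite -(vlerZ_pos _ _ ci) scalerA mulVf ?gt_eqF// scale1r.
by apply: vjoin_lub; rewrite -(vlerZ_pos _ _ c0) scalerA divff ?gt_eqF//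
  scale1r ?vjoin_lel ?vjoin_ler.
Qed.

Lemma vabs_le x y : (vabs x <= y) = (x <= y) && (- x <= y).
Proof. exact: vjoin_le. Qed.

Lemma ler_vabs x : x <= vabs x.
Proof. exact: vjoin_lel. Qed.

Lemma lerN_vabs x : - x <= vabs x.
Proof. exact: vjoin_ler. Qed.

Lemma vabsN x : vabs (- x) = vabs x.
Proof.
by apply: le_anti; rewrite !vabs_le opprK !ler_vabs lerN_vabs -[x in x <= _]opprK
  lerN_vabs.
Qed.

Lemma vabs_ge0 x : 0 <= vabs x.
Proof.
have : 0 <= 2^-1 *: (vabs x + vabs x).
  apply: vlattice_scaler_ge0; first by rewrite invr_ge0.
  by rewrite -(subrr x) vlerD ?ler_vabs ?lerN_vabs.
by rewrite -mulr2n -[vabs x *+ 2]scaler_nat scalerA mulVf ?scale1r ?pnatr_eq0.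
Qed.

Lemma vabs_ge0P x : 0 <= x -> vabs x = x.
Proof.
move=> x0; apply: le_anti; rewrite ler_vabs vabs_le lexx/= andbT.
by rewrite (le_trans _ x0)// -oppr0 vlerN2.
Qed.

Lemma vabs0 : vabs (0 : V) = 0.
Proof. exact: vabs_ge0P. Qed.

Lemma vabs_id x : vabs (vabs x) = vabs x.
Proof. exact/vabs_ge0P/vabs_ge0. Qed.

Lemma vabsD x y : vabs (x + y) <= vabs x + vabs y.
Proof. by rewrite vabs_le opprD !vlerD ?ler_vabs ?lerN_vabs. Qed.

Lemma vabsB x y : vabs (x - y) = vabs (y - x).
Proof. by rewrite -vabsN opprB. Qed.

Lemma vabs_sum n (f : 'I_n -> V) : vabs (\sum_i f i) <= \sum_i vabs (f i).
Proof.
elim/big_ind2: _ => [|x u y v xu yv|//]; first by rewrite vabs0.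
exact: le_trans (vabsD _ _) (vlerD xu yv).
Qed.

Lemma vabsZ a x : vabs (a *: x) = `|a| *: vabs x.
Proof.
wlog a0 : a x / 0 < a => [hw|].
  have [a0|a0|->] := ltrgtP a 0; last by rewrite normr0 !scale0r vabs0.
    have := hw (- a) x; rewrite oppr_gt0 => /(_ a0).
    by rewrite scaleNr vabsN normrN.
  exact: hw.
by rewrite gtr0_norm// /vabs -scalerN vjoinZ.
Qed.

Lemma vjoin_ge0 x y : 0 <= x -> 0 <= vjoin x y.
Proof. by move=> x0; apply: le_trans x0 (vjoin_lel _ _). Qed.

Lemma vjoin_le_add x y : 0 <= x -> 0 <= y -> vjoin x y <= x + y.
Proof.
move=> x0 y0; apply: vjoin_lub; first by rewrite -[leLHS]addr0 vlerD2l.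
by rewrite -[leLHS]add0r vlerD2r.
Qed.

Lemma ler_vbigjoin n (f : 'I_n -> V) i : f i <= \big[vjoin/0]_(k < n) f k.
Proof.
elim: n f i => [|n IH] f i; first by case: i.
rewrite big_ord_recl; case: (unliftP ord0 i) => [j ->|->].
  by apply: le_trans (vjoin_ler _ _); exact: (IH (fun k => f (lift ord0 k))).
exact: vjoin_lel.
Qed.

(** The witness is [x] truncated to the interval from [- u] to [u]; as |x| <= u + v, the truncation
    removes at most [v]. *)
Lemma riesz_decomposition x u v : 0 <= u -> 0 <= v -> vabs x <= u + v ->
  exists2 y, vabs y <= u & vabs (x - y) <= v.
Proof.
move=> u0 v0; rewrite vabs_le => /andP[x1 x2].
have Nu : - u <= u by rewrite (@le_trans _ _ 0)// -oppr0 vlerN2.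
exists (vjoin (vmeet x u) (- u)).
  rewrite vabs_le vjoin_lub ?vmeet_ler//= -[leRHS]opprK vlerN2.
  exact: vjoin_ler.
rewrite vabs_le opprB !vlerBlDr; apply/andP; split.
  rewrite addrC -vlerBlDr (le_trans _ (vjoin_lel _ _))// vmeet_glb//.
    by rewrite vlerBlDr -[leLHS]addr0 vlerD2l.
  by rewrite vlerBlDr.
apply: vjoin_lub.
  by rewrite (le_trans (vmeet_lel _ _))// -[leLHS]add0r vlerD2r.
by rewrite -vlerN2 opprK opprD addrC vlerBlDr.
Qed.

Lemma principal_idealD e a x y : 0 <= e ->
  principal_ideal e x -> principal_ideal e y -> principal_ideal e (a *: x + y).
Proof.
move=> e0 [b xb] [c yc]; exists (`|a| * b + c).
rewrite (le_trans (vabsD _ _))// scalerDl vlerD// vabsZ -scalerA.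
exact: vlerZl.
Qed.

Lemma principal_ideal0 e : principal_ideal e 0.
Proof. by exists 0; rewrite scale0r vabs0. Qed.

Lemma principal_idealZ e a x : 0 <= e ->
  principal_ideal e x -> principal_ideal e (a *: x).
Proof.
by move=> e0 Ix; rewrite -[_ *: _]addr0; apply: principal_idealD => //;
  exact: principal_ideal0.
Qed.

Lemma principal_idealA e x y : 0 <= e ->
  principal_ideal e x -> principal_ideal e y -> principal_ideal e (x + y).
Proof. by move=> e0 Ix Iy; rewrite -[x]scale1r; exact: principal_idealD. Qed.

Lemma principal_idealN e x : 0 <= e ->
  principal_ideal e x -> principal_ideal e (- x).
Proof. by move=> e0 Ix; rewrite -scaleN1r; exact: principal_idealZ. Qed.

Lemma principal_idealB e x y : 0 <= e ->
  principal_ideal e x -> principal_ideal e y -> principal_ideal e (x - y).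
Proof.
by move=> e0 Ix Iy; apply: principal_idealA => //; exact: principal_idealN.
Qed.

Lemma principal_ideal_self e : 0 <= e -> principal_ideal e e.
Proof. by move=> e0; exists 1; rewrite scale1r vabs_ge0P. Qed.

Lemma principal_ideal_solid e x y :
  principal_ideal e y -> vabs x <= vabs y -> principal_ideal e x.
Proof. by move=> [a ya] xy; exists a; exact: le_trans xy ya. Qed.

Lemma principal_ideal_vabs e x : principal_ideal e x -> principal_ideal e (vabs x).
Proof. by move=> /principal_ideal_solid; apply; rewrite vabs_id. Qed.

Lemma principal_ideal_vjoin e x y : 0 <= e ->
  principal_ideal e x -> principal_ideal e y -> principal_ideal e (vjoin x y).
Proof.
move=> e0 /principal_ideal_vabs Ix /principal_ideal_vabs Iy.
apply: (principal_ideal_solid (principal_idealA e0 Ix Iy)).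
rewrite [leRHS]vabs_ge0P ?vaddr_ge0 ?vabs_ge0// vabs_le; apply/andP; split.
  apply: vjoin_lub; rewrite (le_trans (ler_vabs _))//.
    by rewrite -[leLHS]addr0 vlerD2l vabs_ge0.
  by rewrite -[leLHS]add0r vlerD2r vabs_ge0.
rewrite (@le_trans _ _ (- x)) ?vlerN2 ?vjoin_lel// (le_trans (lerN_vabs _))//.
by rewrite -[leLHS]addr0 vlerD2l vabs_ge0.
Qed.

Lemma principal_ideal_vmeet e x y : 0 <= e ->
  principal_ideal e x -> principal_ideal e y -> principal_ideal e (vmeet x y).
Proof.
move=> e0 Ix Iy; rewrite vmeetE; apply/principal_idealN/principal_ideal_vjoin => //;
  exact: principal_idealN.
Qed.

Lemma principal_ideal_itv e x : 0 <= x <= e -> principal_ideal e x.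
Proof. by case/andP=> x0 xe; exists 1; rewrite scale1r vabs_ge0P. Qed.

End VectorLatticeTheory.

(** * Kakutani's representation theorem *)

Section Infimum.
Variable R : realType.
Implicit Types (A B : set R) (m a b c : R).

Lemma le_inf_add A B m : A !=set0 -> B !=set0 ->
  (forall a b, A a -> B b -> m <= a + b) -> m <= inf A + inf B.
Proof.
move=> A0 B0 mAB; rewrite -lerBlDr; apply: lb_le_inf => // a Aa.
rewrite lerBlDr -lerBlDl; apply: lb_le_inf => // b Bb.
by rewrite lerBlDl mAB.
Qed.

Lemma le_inf_max A B m : A !=set0 -> B !=set0 ->
  (forall a b, A a -> B b -> m <= Num.max a b) -> m <= Num.max (inf A) (inf B).
Proof.
move=> A0 B0 mAB; rewrite leNgt gt_max; apply/negP => /andP[].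
move=> /(inf_lt A0)[a Aa am] /(inf_lt B0)[b Bb bm].
by have := mAB a b Aa Bb; rewrite leNgt gt_max am bm.
Qed.

Lemma le_inf_mull A c m : 0 < c -> A !=set0 ->
  (forall a, A a -> m <= c * a) -> m <= c * inf A.
Proof.
move=> c0 A0 mA; rewrite -ler_pdivrMl//; apply: lb_le_inf => // a Aa.
by rewrite ler_pdivrMl// mA.
Qed.

End Infimum.

(** Otherwise the complements of the sets with [P] would form a proper filter, and a cluster point
    of it would have no neighbourhood with [P]. This stands in for finite subcovers in
    [gelfand_dense]. *)
Lemma compact_subset_ind (X : topologicalType) (P : set X -> Prop) :
  compact [set: X] -> P set0 -> (forall A B, P A -> P B -> P (A `|` B)) ->
  (forall A B, A `<=` B -> P B -> P A) ->
  (forall x : X, exists2 U, nbhs x U & P U) -> P setT.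
Proof.
move=> cX P0 PU PS Px; apply: contrapT => nPT.
pose F : set_system X := [set A | P (~` A)].
have FF : ProperFilter F.
  split; first by rewrite /F/= setC0.
  split; rewrite /F/=.
  - by rewrite setCT.
  - by move=> A B PA PB /=; rewrite setCI; exact: PU.
  - by move=> A B AB; apply: PS; exact: subsetC.
have [|x [_ clx]] := cX F FF; first by rewrite /F/= setCT.
have [U xU PU'] := Px x.
by have [|y [/= nUy]] := clx (~` U) U _ xU; first by rewrite /F/= setCK.
Qed.

Lemma compact_set_type (X : topologicalType) (A : set X) :
  compact A -> compact [set: set_type A].
Proof.
move=> cA F FF _.
have [|x [Ax clx]] := cA (set_val @ F) _.
  by apply: (@filterS _ F _ setT) filterT => y _; exact: set_valP.
exists (SigSub (mem_set Ax)); split => // B U FB [W [[W' oW' W'W] Wx WU]].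
have [||_ [[b Bb <-] Wb]] := clx (set_val @` B) W'.
- by apply: (@filterS _ F _ B) FB => b Bb; exists b.
- apply: open_nbhs_nbhs; split => //.
  by move: Wx; rewrite -W'W.
- by exists b; split => //; apply: WU; rewrite -W'W.
Qed.

Section Kakutani.
Variables (R : realType) (V : vectorLatticeType R) (e : V).
Hypothesis e0 : 0 <= e.
Local Notation I := (principal_ideal e).
Implicit Types (p q : V -> R) (x y : V) (a c : R).

Record sublinear_functional p : Prop := SublinearFunctional {
  slf_le : forall x y, I x -> I y -> x <= y -> p x <= p y ;
  slf_add : forall x y, I x -> I y -> p (x + y) <= p x + p y ;
  slf_scale : forall c x, 0 < c -> I x -> p (c *: x) <= c * p x ;
  slf_join : forall x y, I x -> I y -> p (vjoin x y) <= Num.max (p x) (p y) ;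
  slf_unit : forall a x, I x -> p (x + a *: e) = p x + a
}.

Lemma slf0 p : sublinear_functional p -> p 0 = 0.
Proof.
move=> sp; have I0 := principal_ideal0 e.
apply/eqP; rewrite eq_le; apply/andP; split.
  have /(slf_scale sp) : (0 : R) < 2^-1 by [].
  by move=> /(_ _ I0); rewrite scaler0; lra.
by have := slf_add sp I0 I0; rewrite addr0; lra.
Qed.

Lemma slf_unitE p a : sublinear_functional p -> p (a *: e) = a.
Proof.
move=> sp; rewrite -[_ *: _]add0r (slf_unit sp) ?slf0 ?add0r//.
exact: principal_ideal0.
Qed.

Lemma slf_oppr p x : sublinear_functional p -> I x -> - p (- x) <= p x.
Proof.
move=> sp Ix; have := slf_add sp Ix (principal_idealN e0 Ix).
by rewrite subrr slf0//; lra.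
Qed.

(** Every clause survives an infimum once any two members are dominated by a third at the vectors
    concerned. The family is a chain in [slf_minimal]; in [slf_cut] it is indexed by nonnegative
    reals, which get added or rescaled. *)
Lemma slf_inf (A : set (V -> R)) : A !=set0 ->
  (forall x, I x -> exists m, forall p, A p -> m <= p x) ->
  (forall p, A p -> forall x y, I x -> I y -> x <= y -> p x <= p y) ->
  (forall p q x y, A p -> A q -> I x -> I y ->
     exists2 r, A r & r (x + y) <= p x + q y) ->
  (forall p c x, A p -> 0 < c -> I x -> exists2 r, A r & r (c *: x) <= c * p x) ->
  (forall p q x y, A p -> A q -> I x -> I y ->
     exists2 r, A r & r (vjoin x y) <= Num.max (p x) (q y)) ->
  (forall p, A p -> forall a x, I x -> p (x + a *: e) = p x + a) ->
  sublinear_functional (fun x => inf [set p x | p in A]).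
Proof.
move=> [p0 Ap0] lb mono add scale join unit.
have ne x : [set p x | p in A] !=set0 by exists (p0 x), p0.
have inf_le x p : I x -> A p -> inf [set p x | p in A] <= p x.
  move=> Ix Ap; have [m mp] := lb x Ix; apply: ge_inf; last by exists p.
  by exists m => _ [q Aq <-]; exact: mp.
split.
- move=> x y Ix Iy xy; apply: lb_le_inf => // _ [p Ap <-].
  by rewrite (le_trans (inf_le _ _ Ix Ap))// mono.
- move=> x y Ix Iy; apply: le_inf_add => // _ _ [p Ap <-] [q Aq <-].
  have [r Ar] := add p q x y Ap Aq Ix Iy; apply: le_trans.
  by apply: inf_le => //; exact: principal_idealA.
- move=> c x c0 Ix; apply: le_inf_mull => // _ [p Ap <-].
  have [r Ar] := scale p c x Ap c0 Ix; apply: le_trans.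
  by apply: inf_le => //; exact: principal_idealZ.
- move=> x y Ix Iy; apply: le_inf_max => // _ _ [p Ap <-] [q Aq <-].
  have [r Ar] := join p q x y Ap Aq Ix Iy; apply: le_trans.
  by apply: inf_le => //; exact: principal_ideal_vjoin.
- move=> a x Ix; have Ixa : I (x + a *: e).
    by rewrite addrC; apply: principal_idealD => //; exact: principal_ideal_self.
  apply: le_anti; apply/andP; split.
    rewrite -lerBlDr; apply: lb_le_inf => // _ [p Ap <-].
    by rewrite lerBlDr -unit// inf_le.
  apply: lb_le_inf => // _ [p Ap <-].
  by rewrite unit// lerD2r inf_le.
Qed.

(** [q] is the analogue, for a functional [p = sup_K] with [K] a set of
    characters, of the supremum over the part of [K] where [x >= p x]. *)
Lemma slf_cut p x : sublinear_functional p -> I x ->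
  exists q, [/\ sublinear_functional q, forall y, I y -> q y <= p y &
                q (- x) <= - p x].
Proof.
move=> sp Ix; pose u := x - p x *: e; pose w := vjoin (- u) 0.
have Ie := principal_ideal_self e0.
have Iu : I u by apply: principal_idealB => //; exact: principal_idealZ.
have I0 := principal_ideal0 e.
have Iw : I w by apply: principal_ideal_vjoin => //; exact: principal_idealN.
have INw : I (- w) by exact: principal_idealN.
have w0 : 0 <= w by exact: vjoin_ler.
have pu : p u = 0 by rewrite /u -scaleNr slf_unit// subrr.
(* [u] is its positive part minus [w], and maxitivity bounds [p] of the positive part by
   [max 0 (p u) = 0]; so [0 = p u <= p (- w)]. This keeps the infimum below finite. *)
have pNw : 0 <= p (- w).
  have uE : u = vjoin 0 u - w.
    by rewrite /w -[X in _ = X - _](addrK (- u)) -vjoinD add0r subrr opprK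
      [X in _ = X - _]addrC addrK.
  have Iu0 : I (vjoin 0 u) by exact: principal_ideal_vjoin.
  have := slf_add sp Iu0 INw; rewrite -uE pu => /le_trans; apply.
  rewrite gerDr (le_trans (slf_join sp I0 Iu))// slf0// pu.
  by rewrite maxxx.
have pNaw a : 0 <= a -> 0 <= p (- (a *: w)).
  rewrite le_eqVlt => /predU1P[<-|a0]; first by rewrite scale0r oppr0 slf0.
  have ai : 0 < a^-1 by rewrite invr_gt0.
  have := slf_scale sp ai (principal_idealN e0 (principal_idealZ a e0 Iw)).
  rewrite -scalerN scalerA mulVf ?gt_eqF// scale1r => /(le_trans pNw).
  by rewrite pmulr_rge0.
have Iaw a y : I y -> I (y - a *: w).
  by move=> Iy; apply: principal_idealB => //; exact: principal_idealZ.
pose A := [set (fun y => p (y - a *: w)) | a in [set a : R | 0 <= a]].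
have Alb y : I y -> exists m, forall q, A q -> m <= q y.
  move=> Iy; exists (- p (- y)) => _ [a /= a0 <-].
  have := slf_add sp (principal_idealN e0 Iy) (Iaw a y Iy).
  by rewrite addKr; have := pNaw _ a0; lra.
exists (fun y => inf [set q y | q in A]); split.
- apply: slf_inf.
  + by exists (fun y => p (y - 0 *: w)), 0 => //=.
  + exact: Alb.
  + move=> _ [a a0 <-] y z Iy Iz yz.
    by apply: (slf_le sp); rewrite ?vlerD2r//; exact: Iaw.
  + move=> _ _ y z [a /= a0 <-] [b /= b0 <-] Iy Iz.
    exists (fun y => p (y - (a + b) *: w)).
      by exists (a + b) => //=; exact: addr_ge0.
    rewrite scalerDl opprD addrACA; apply: slf_add => //; exact: Iaw.
  + move=> _ c y [a /= a0 <-] c0 Iy; exists (fun y => p (y - (c * a) *: w)).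
      by exists (c * a) => //=; rewrite mulr_ge0// ltW.
    by rewrite -scalerA -scalerBr; apply: slf_scale => //; exact: Iaw.
  + move=> _ _ y z [a /= a0 <-] [b /= b0 <-] Iy Iz.
    exists (fun y => p (y - (a + b) *: w)).
      by exists (a + b) => //=; exact: addr_ge0.
    apply: le_trans (slf_join sp (Iaw _ _ Iy) (Iaw _ _ Iz)).
    apply: (slf_le sp); first exact/Iaw/principal_ideal_vjoin.
      by apply: principal_ideal_vjoin => //; exact: Iaw.
    rewrite vlerBlDr; apply: vjoin_lub.
      rewrite -vlerBlDr (le_trans _ (vjoin_lel _ _))// vlerD2l vlerN2.
      by rewrite vlerZr// lerDl.
    rewrite -vlerBlDr (le_trans _ (vjoin_ler _ _))// vlerD2l vlerN2.
    by rewrite vlerZr// lerDr.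
  + move=> _ [b _ <-] a y Iy /=.
    by rewrite addrAC slf_unit//; exact: Iaw.
- move=> y Iy; have [m mA] := Alb y Iy; apply: ge_inf.
    by exists m => _ [q Aq <-]; exact: mA.
  by exists (fun y => p (y - 0 *: w)); [exists 0 => //=|rewrite scale0r subr0].
- have INx := principal_idealN e0 Ix.
  have [m mA] := Alb _ INx.
  (* Already [a = 1] is enough: [w >= p x *: e - x] gives [- x - w <= - p x *: e]. *)
  apply: (@le_trans _ _ (p (- x - 1 *: w))).
    apply: ge_inf; first by exists m => _ [q Aq <-]; exact: mA.
    by exists (fun y => p (y - 1 *: w)) => //; exists 1 => //=.
  rewrite -(slf_unitE (- p x) sp); apply: (slf_le sp).
  + exact: Iaw.
  + exact: principal_idealZ.
  + rewrite scale1r scaleNr -opprD vlerN2 addrC -vlerBlDr.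
    by rewrite (le_trans _ (vjoin_lel _ _))// opprB.
Qed.

Lemma slf_minimal p : sublinear_functional p ->
  exists q, [/\ sublinear_functional q, forall x, I x -> q x <= p x &
    forall r, sublinear_functional r -> (forall x, I x -> r x <= q x) ->
      forall x, I x -> q x <= r x].
Proof.
move=> sp; pose PT q := sublinear_functional q /\ forall x, I x -> q x <= p x.
pose T := {q | PT q}.
pose rT (q r : T) := `[< forall x, I x -> sval r x <= sval q x >].
have t0 : T by exists p; split => // x.
have [|||[q [sq qp]] qmin] := @ZL_preorder T t0 rT.
- by move=> q; apply/asboolP.
- move=> q r s /asboolP qr /asboolP rs; apply/asboolP => x Ix.
  exact: le_trans (rs x Ix) (qr x Ix).
- move=> A totA; have [A0|] := pselect (A !=set0); last first.
    by move=> nA; exists t0 => s As; exfalso; apply: nA; exists s.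
  pose B := [set sval q | q in A].
  have tot q r : B q -> B r -> exists2 s, B s & forall x, I x ->
      s x <= q x /\ s x <= r x.
    move=> [q' Aq <-] [r' Ar <-].
    have [/asboolP qr|/asboolP rq] := totA q' r' Aq Ar.
      by exists (sval r'); [exists r'|move=> x Ix; split => //; exact: qr].
    by exists (sval q'); [exists q'|move=> x Ix; split => //; exact: rq].
  have sB q : B q -> sublinear_functional q by move=> [r _ <-]; case: (svalP r).
  (* The chain cannot drop to minus infinity at [x]: [q x >= - q (- x)] and [q (- x) <= p (- x)]. *)
  have lbB x : I x -> exists m, forall q, B q -> m <= q x.
    move=> Ix; exists (- p (- x)) => _ [[q [sq qp]] _ <-] /=.
    rewrite (le_trans _ (slf_oppr sq Ix))// lerN2 qp//.
    exact: principal_idealN.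
  have sinf : sublinear_functional (fun x => inf [set q x | q in B]).
    apply: slf_inf => //.
    - by have [q Aq] := A0; exists (sval q), q.
    - by move=> q /sB sq x y; exact: slf_le.
    - move=> q r x y Bq Br Ix Iy; have [s Bs sle] := tot q r Bq Br.
      exists s => //; apply: le_trans (slf_add (sB _ Bs) Ix Iy) _.
      by apply: lerD; [case: (sle x Ix)|case: (sle y Iy)].
    - by move=> q c x Bq c0 Ix; exists q => //; exact: (slf_scale (sB _ Bq) c0 Ix).
    - move=> q r x y Bq Br Ix Iy; have [s Bs sle] := tot q r Bq Br.
      exists s => //; apply: le_trans (slf_join (sB _ Bs) Ix Iy) _.
      rewrite ge_max !le_max; case: (sle x Ix) => -> _.
      by case: (sle y Iy) => _ ->; rewrite orbT.
    - by move=> q /sB sq a x; exact: slf_unit.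
  have inf_le q x : I x -> B q -> inf [set q x | q in B] <= q x.
    move=> Ix Bq; have [m mB] := lbB x Ix; apply: ge_inf; last by exists q.
    by exists m => _ [r Br <-]; exact: mB.
  have infp x : I x -> inf [set q x | q in B] <= p x.
    move=> Ix; have [[q [sq qp]] Aq] := A0.
    by rewrite (le_trans _ (qp x Ix))// inf_le//; exists (exist PT q (conj sq qp)).
  exists (exist PT _ (conj sinf infp)) => q Aq; apply/asboolP => x Ix /=.
  by apply: inf_le => //; exists q.
exists q; split => // r sr rq x Ix.
have rp y : I y -> r y <= p y by move=> Iy; exact: le_trans (rq y Iy) (qp y Iy).
have /asboolP := qmin (exist PT r (conj sr rp)) (asboolT rq).
by apply.
Qed.

(** The value 0 off the ideal makes a character determined by its restriction to the ideal, so that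
    the spectrum is a bounded closed subset of a product indexed by all of [V]. *)
Definition character p : Prop :=
  [/\ forall x, ~ I x -> p x = 0,
      forall a x y, I x -> I y -> p (a *: x + y) = a * p x + p y,
      forall x y, I x -> I y -> p (vjoin x y) = Num.max (p x) (p y)
    & p e = 1].

(** Cutting [q] at [x] gives a functional below [q] whose value at [- x] is at most [- q x].
    Minimality transfers this to [q], which is therefore odd; odd and sublinear is linear, and
    monotone and maxitive then preserves joins. *)
Lemma minimal_slf_character q : sublinear_functional q ->
  (forall r, sublinear_functional r -> (forall x, I x -> r x <= q x) ->
      forall x, I x -> q x <= r x) ->
  exists2 p, character p & forall x, I x -> p x = q x.
Proof.
move=> sq qmin.
have qN x : I x -> q (- x) = - q x.
  move=> Ix; have INx := principal_idealN e0 Ix.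
  apply: le_anti; apply/andP; split; last first.
    by have := slf_oppr sq Ix; lra.
  have [r [sr rq rx]] := slf_cut sq Ix.
  exact: le_trans (qmin r sr rq _ INx) rx.
have qD x y : I x -> I y -> q (x + y) = q x + q y.
  move=> Ix Iy; apply: le_anti; rewrite (slf_add sq)//=.
  have Ixy := principal_idealA e0 Ix Iy.
  have := slf_add sq Ixy (principal_idealN e0 Iy).
  by rewrite addrK qN//; lra.
have qZ0 c x : 0 < c -> I x -> q (c *: x) = c * q x.
  move=> c0 Ix; apply: le_anti; rewrite (slf_scale sq)//=.
  have ci : 0 < c^-1 by rewrite invr_gt0.
  have := slf_scale sq ci (principal_idealZ c e0 Ix).
  by rewrite scalerA mulVf ?gt_eqF// scale1r ler_pdivlMl.
have qZ c x : I x -> q (c *: x) = c * q x.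
  move=> Ix; have [c0|c0|->] := ltrgtP c 0.
  - rewrite -[c]opprK scaleNr qN ?qZ0 ?oppr_gt0 ?mulNr//.
    exact: principal_idealZ.
  - exact: qZ0.
  - by rewrite scale0r mul0r slf0.
exists (fun x => if `[< I x >] then q x else 0); last first.
  by move=> x /asboolT ->.
split.
- by move=> x /asboolF ->.
- move=> a x y Ix Iy; rewrite !asboolT//; last exact: principal_idealD.
  by rewrite qD ?qZ//; exact: principal_idealZ.
- move=> x y Ix Iy; have Ixy := principal_ideal_vjoin e0 Ix Iy.
  rewrite !asboolT//; apply: le_anti; rewrite (slf_join sq)//= ge_max.
  by rewrite !(slf_le sq)// ?vjoin_lel ?vjoin_ler.
- have Ie := principal_ideal_self e0.
  by rewrite asboolT// -[e in q e]scale1r slf_unitE.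
Qed.

Hypothesis archi : forall x, (forall n, n%:R *: x <= e) -> x <= 0.

(** This is the largest functional of the kind, hence the one to start from. For [e = 0] the set
    under the infimum would be the whole line. *)
Lemma slf_gauge : e != 0 ->
  sublinear_functional (fun x => inf [set a | x <= a *: e]).
Proof.
move=> e_neq0.
have ne x : I x -> [set a | x <= a *: e] !=set0.
  by move=> [a xa]; exists a; exact: le_trans (ler_vabs _) xa.
have glb x : I x -> has_lbound [set a | x <= a *: e].
  move=> [b xb]; exists (- b) => a /= xa; rewrite leNgt; apply/negP => ab.
  have : (- b - a) *: e <= 0.
    rewrite scalerBl vlerBlDr add0r scaleNr (le_trans _ xa)//.
    by rewrite -[leRHS]opprK vlerN2 (le_trans (lerN_vabs _)).
  rewrite -[leRHS](scaler0 _ (- b - a)) vlerZ_pos ?subr_gt0// => e_le0.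
  by move/eqP: e_neq0; apply; apply: le_anti; rewrite e_le0.
have inf_le x a : I x -> x <= a *: e -> inf [set a | x <= a *: e] <= a.
  by move=> Ix xa; apply: ge_inf => //; exact: glb.
split.
- move=> x y Ix Iy xy; apply: lb_le_inf; first exact: ne.
  by move=> a /= ya; apply: inf_le => //; exact: le_trans ya.
- move=> x y Ix Iy; apply: le_inf_add; try exact: ne.
  move=> a b /= xa yb; apply: inf_le; first exact: principal_idealA.
  by rewrite scalerDl vlerD.
- move=> c x c0 Ix; apply: le_inf_mull => //; first exact: ne.
  move=> a /= xa; apply: inf_le; first exact: principal_idealZ.
  by rewrite -scalerA vlerZ_pos.
- move=> x y Ix Iy; apply: le_inf_max; try exact: ne.
  move=> a b /= xa yb; apply: inf_le; first exact: principal_ideal_vjoin.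
  apply: vjoin_lub; [apply: le_trans xa _|apply: le_trans yb _];
    by rewrite vlerZr// le_max lexx ?orbT.
- move=> a x Ix; have Ixa : I (x + a *: e).
    by rewrite addrC; apply: principal_idealD => //; exact: principal_ideal_self.
  apply: le_anti; apply/andP; split.
    rewrite -lerBlDr; apply: lb_le_inf; first exact: ne.
    move=> b /= xb; rewrite lerBlDr; apply: inf_le => //.
    by rewrite scalerDl vlerD2r.
  apply: lb_le_inf; first exact: ne.
  move=> b /= xb; rewrite -lerBrDr; apply: inf_le => //.
  by rewrite scalerBl vlerBrDr.
Qed.

(** If the gauge is positive at [x], a minimal functional below its cut at [x] is a character
    positive at [x]. If not, [x] is below every positive multiple of [e] and [archi] applies. *)
Lemma character_separation x : I x -> (forall p, character p -> p x <= 0) ->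
  x <= 0.
Proof.
move=> Ix px; have [e_eq0|e_neq0] := eqVneq e 0.
  have [a] := Ix; rewrite e_eq0 scaler0; exact: le_trans (ler_vabs _).
have sg := slf_gauge e_neq0; set g := (fun x => _) in sg.
have [g0|g0] := leP (g x) 0.
  apply: archi => -[|n]; first by rewrite scale0r.
  have [a] : exists2 a, [set a | x <= a *: e] a & a < n.+1%:R^-1.
    apply: inf_lt; last by rewrite (le_lt_trans g0)// invr_gt0.
    by have [a xa] := Ix; exists a; exact: le_trans (ler_vabs _) xa.
  move=> /= xa an; have n0 : 0 < n.+1%:R :> R by [].
  rewrite (le_trans (vlerZl (ltW n0) xa))// scalerA -[leRHS]scale1r vlerZr//.
  by rewrite mulrC -ler_pdivlMr// div1r ltW.
have [r [sr rg rx]] := slf_cut sg Ix.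
have [q [sq qr qmin]] := slf_minimal sr.
have [p cp pq] := minimal_slf_character sq qmin.
have INx := principal_idealN e0 Ix.
have := px p cp; rewrite pq// => qx.
by exfalso; have := slf_oppr sq Ix; have := qr _ INx; lra.
Qed.

End Kakutani.

(** * The spectrum of an order unit and its continuous functions *)

Section KakutaniRepresentation.
Variables (R : realType) (V : vectorLatticeType R) (e : V).
Hypothesis e0 : 0 <= e.
Local Notation I := (principal_ideal e).

Definition spectrum := set_type (@character R V e : set {ptws V -> R}).

HB.instance Definition _ := Topological.on spectrum.

Definition gelfand (x : V) (w : spectrum) : R := set_val w x.

Lemma continuous_gelfand x : continuous (gelfand x).
Proof.
move=> w; apply: (@continuous_comp spectrum {ptws V -> R} R set_val (@proj V (fun=> R) x)).
  exact: initial_continuous.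
exact: proj_continuous.
Qed.

Lemma spectrum_eqP (p q : spectrum) : (forall x, gelfand x p = gelfand x q) -> p = q.
Proof. by move=> pq; apply: val_inj; apply/funext. Qed.

Lemma hausdorff_spectrum : hausdorff_space spectrum.
Proof.
move=> p q pq; apply: spectrum_eqP => x.
apply: (@Rhausdorff R) => A B pA qB.
have [w [Aw Bw]] := pq _ _ (continuous_gelfand pA) (continuous_gelfand qB).
by exists (gelfand x w).
Qed.

(** If |x| <= b e, characters take values in [-b, b] at [x], so the spectrum lies in a product of
    segments. Each defining condition equates a function continuous for pointwise convergence to a
    constant, hence is closed. *)
Lemma compact_spectrum : compact [set: spectrum].
Proof.
apply: compact_set_type.
have bnd x : exists b : R, forall p, character e p -> - b <= p x <= b.
  have [[b xb]|nI] := pselect (I x); last first.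
    by exists 0 => p [p0 _ _ _]; rewrite p0// oppr0 lexx.
  exists b => p [_ plin pjoin pe].
  have I0 := principal_ideal0 e.
  have Ie := principal_ideal_self e0.
  have Ix : I x by exists b.
  have p0 : p 0 = 0.
    by have := plin 1 0 0 I0 I0; rewrite scaler0 addr0; lra.
  have pZ a y : I y -> p (a *: y) = a * p y.
    by move=> Iy; have := plin a y 0 Iy I0; rewrite !addr0 p0 addr0.
  have mono y z : I y -> I z -> y <= z -> p y <= p z.
    move=> Iy Iz; rewrite -vjoin_eqr => /eqP <-.
    by rewrite pjoin// le_max lexx.
  have Ibe a : I (a *: e) by exact: principal_idealZ.
  have pbe a : p (a *: e) = a by rewrite pZ// pe mulr1.
  have -> : (- b <= p x <= b) = (p (- b *: e) <= p x <= p (b *: e)).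
    by rewrite !pbe.
  rewrite !mono//.
    exact: le_trans (ler_vabs _) xb.
  by rewrite scaleNr -[leRHS]opprK vlerN2 (le_trans (lerN_vabs _)).
pose b x := sval (cid (bnd x)).
have bP x p : character e p -> - b x <= p x <= b x.
  exact: (svalP (cid (bnd x))).
apply: (@subclosed_compact _ _
  [set f : {ptws V -> R} | forall x, `[- b x, b x]%classic (f x)]).
- have -> : (@character R V e : set {ptws V -> R}) =
      (\bigcap_(x in [set x | ~ I x]) [set f : {ptws V -> R} | f x = 0])
      `&` ((\bigcap_(u in [set u : R * V * V | I u.1.2 /\ I u.2])
             [set f : {ptws V -> R} |
                f (u.1.1 *: u.1.2 + u.2) - (u.1.1 * f u.1.2 + f u.2) = 0])
      `&` ((\bigcap_(u in [set u : V * V | I u.1 /\ I u.2])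
             [set f : {ptws V -> R} |
                f (vjoin u.1 u.2) - Num.max (f u.1) (f u.2) = 0])
      `&` [set f : {ptws V -> R} | f e = 1])).
    apply/seteqP; split => p.
      move=> [p0 plin pjoin pe]; split; [|split; [|split]] => //.
        by move=> [[a x] y] /= [Ix Iy]; rewrite plin// subrr.
      by move=> [x y] /= [Ix Iy]; rewrite pjoin// subrr.
    move=> [p0 [plin [pjoin pe]]]; split => //.
      by move=> a x y Ix Iy; apply/subr0_eq/(plin (a, x, y)).
    by move=> x y Ix Iy; apply/subr0_eq/(pjoin (x, y)).
  have cproj x : continuous (fun f : {ptws V -> R} => f x : R).
    exact: (@proj_continuous V (fun=> R) x).
  have clz (g : {ptws V -> R} -> R) c : continuous g ->
      closed [set f : {ptws V -> R} | g f = c].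
    move=> cg; rewrite (_ : [set f | _] = g @^-1` [set c])//.
    by apply: closed_comp => [x _|]; [exact: cg|exact: closed_eq].
  apply: closedI; first by apply: closed_bigI => x _; exact: clz.
  apply: closedI.
    apply: closed_bigI => u _; apply: clz => f.
    exact: cvgB (cproj _ f) (cvgD (cvgM (cvg_cst _) (cproj _ f)) (cproj _ f)).
  apply: closedI; last exact: clz.
  apply: closed_bigI => u _; apply: clz => f.
  exact: cvgB (cproj _ f) (continuous_max (cproj _ f) (cproj _ f)).
- apply: (@tychonoff V (fun=> R) (fun x => `[- b x, b x]%classic)) => x.
  exact: segment_compact.
- move=> p cp x /=; rewrite in_itv/=; exact: bP.
Qed.

Lemma gelfand_linear a x y w : I x -> I y ->
  gelfand (a *: x + y) w = a * gelfand x w + gelfand y w.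
Proof. by case: (set_valP w) => _ + _ _; apply. Qed.

Lemma gelfand_vjoin x y w : I x -> I y ->
  gelfand (vjoin x y) w = Num.max (gelfand x w) (gelfand y w).
Proof. by case: (set_valP w) => _ _ + _; apply. Qed.

Lemma gelfand_unit w : gelfand e w = 1.
Proof. by case: (set_valP w). Qed.

Lemma gelfand0 w : gelfand 0 w = 0.
Proof.
have I0 := principal_ideal0 e.
by have := gelfand_linear 1 w I0 I0; rewrite scaler0 addr0; lra.
Qed.

Lemma gelfandZ a x w : I x -> gelfand (a *: x) w = a * gelfand x w.
Proof.
move=> Ix; have := gelfand_linear a w Ix (principal_ideal0 e).
by rewrite !addr0 gelfand0 addr0.
Qed.

Lemma gelfandD x y w : I x -> I y ->
  gelfand (x + y) w = gelfand x w + gelfand y w.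
Proof. by move=> Ix Iy; rewrite -[x]scale1r gelfand_linear// scale1r mul1r. Qed.

Lemma gelfandN x w : I x -> gelfand (- x) w = - gelfand x w.
Proof. by move=> Ix; rewrite -scaleN1r gelfandZ// mulN1r. Qed.

Lemma gelfandB x y w : I x -> I y ->
  gelfand (x - y) w = gelfand x w - gelfand y w.
Proof.
by move=> Ix Iy; rewrite gelfandD ?gelfandN//; exact: principal_idealN.
Qed.

Lemma gelfand_vmeet x y w : I x -> I y ->
  gelfand (vmeet x y) w = Num.min (gelfand x w) (gelfand y w).
Proof.
move=> Ix Iy; have INx := principal_idealN e0 Ix.
have INy := principal_idealN e0 Iy.
rewrite vmeetE gelfandN ?gelfand_vjoin ?gelfandN//.
  by rewrite -oppr_min opprK.
exact: principal_ideal_vjoin.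
Qed.

Hypothesis archi : forall x, (forall n, n%:R *: x <= e) -> x <= 0.

Lemma gelfand_le x y : I x -> I y -> (forall w, gelfand x w <= gelfand y w) -> x <= y.
Proof.
move=> Ix Iy xy; rewrite -[x <= y]vlerN2 -vsubr_ge0 opprK addrC -[leRHS]opprK.
rewrite -[leLHS]oppr0 vlerN2 opprD opprK addrC.
have Ixy := principal_idealB e0 Ix Iy.
apply: (character_separation e0 archi Ixy) => p cp.
have := xy (SigSub (mem_set cp)).
rewrite -subr_le0 -gelfandB//.
Qed.

Lemma gelfand_inj x y : I x -> I y -> (forall w, gelfand x w = gelfand y w) -> x = y.
Proof.
by move=> Ix Iy xy; apply: le_anti; rewrite !gelfand_le// => w; rewrite xy.
Qed.

(** An element separating [p] from [q], combined with the constants given by [e], takes any two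
    prescribed values: this is the input of the lattice Stone-Weierstrass argument. *)
Lemma gelfand_interpolation (f : spectrum -> R) p q :
  exists2 x, I x & gelfand x p = f p /\ gelfand x q = f q.
Proof.
have Ie := principal_ideal_self e0.
have [<-|pq] := pselect (p = q).
  by exists (f p *: e); [exact: principal_idealZ|rewrite gelfandZ// gelfand_unit mulr1].
have [y [Iy yp]] : exists y, I y /\ gelfand y p != gelfand y q.
  apply: contrapT => npq; apply: pq; apply: spectrum_eqP => y.
  have [Iy|nIy] := pselect (I y).
    by apply: contrapT => /eqP ypq; apply: npq; exists y.
  have := set_valP p; have := set_valP q.
  by move=> [q0 _ _ _] [p0 _ _ _]; exact: etrans (p0 _ nIy) (esym (q0 _ nIy)).
pose a := (f p - f q) / (gelfand y p - gelfand y q).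
exists (a *: y + (f p - a * gelfand y p) *: e).
  by apply: principal_idealD => //; exact: principal_idealZ.
have Ibe b : I (b *: e) by exact: principal_idealZ.
rewrite !gelfand_linear// !gelfandZ// !gelfand_unit; split; first by ring.
by rewrite /a; field; rewrite subr_eq0.
Qed.

Lemma gelfand_dense (f : spectrum -> R) (eps : R) : continuous f -> 0 < eps ->
  exists2 x, I x & forall w, `|gelfand x w - f w| <= eps.
Proof.
move=> cf eps0; have [[p0 _]|noO] := pselect ([set: spectrum] !=set0); last first.
  exists 0; first exact: principal_ideal0.
  by move=> w; exfalso; apply: noO; exists w.
have cg x : continuous (fun w => gelfand x w - f w).
  by move=> w; exact: cvgB (@continuous_gelfand x w) (cf w).
(* Finite joins of interpolants through [p] lie above [f - eps] everywhere; finite meets of the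
   results, below, also get under [f + eps]. *)
have below p : exists2 x, I x &
    gelfand x p = f p /\ forall w, - eps <= gelfand x w - f w.
  pose P A := exists2 x, I x &
    gelfand x p = f p /\ forall w, A w -> - eps <= gelfand x w - f w.
  suff [x Ix [xp xf]] : P setT by exists x => //; split => // w; exact: xf.
  apply: compact_subset_ind; first exact: compact_spectrum.
  - by have [x Ix [xp _]] := gelfand_interpolation f p p; exists x.
  - move=> A B [x Ix [xp xA]] [y Iy [yp yB]].
    exists (vjoin x y); first exact: principal_ideal_vjoin.
    split; first by rewrite gelfand_vjoin// xp yp maxxx.
    move=> w [/xA|/yB]; rewrite gelfand_vjoin// => h; apply: le_trans h _.
      by rewrite lerD2r le_max lexx.
    by rewrite lerD2r le_max lexx orbT.
  - by move=> A B AB [x Ix [xp xB]]; exists x => //; split => // w /AB; exact: xB.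
  - move=> q; have [x Ix [xp xq]] := gelfand_interpolation f p q.
    exists [set w | - eps < gelfand x w - f w]; last first.
      by exists x => //; split => // w /ltW.
    have := @cvgr_gt _ _ _ _ _ _ (cg x q) (- eps); apply.
    by rewrite xq subrr oppr_lt0.
pose P A := exists2 x, I x & (forall w, - eps <= gelfand x w - f w) /\
  forall w, A w -> gelfand x w - f w <= eps.
suff [x Ix [x1 x2]] : P setT.
  by exists x => // w; rewrite ler_norml x1 x2.
apply: compact_subset_ind; first exact: compact_spectrum.
- by have [x Ix [_ xf]] := below p0; exists x.
- move=> A B [x Ix [x1 xA]] [y Iy [y1 yB]].
  exists (vmeet x y); first exact: principal_ideal_vmeet.
  split=> w; rewrite gelfand_vmeet//.
    by rewrite lerBrDr le_min -!lerBrDr x1 y1.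
  move=> [/xA|/yB]; apply: le_trans.
    by rewrite lerD2r ge_min lexx.
  by rewrite lerD2r ge_min lexx orbT.
- by move=> A B AB [x Ix [x1 xB]]; exists x => //; split => // w /AB; exact: xB.
- move=> q; have [x Ix [xq xf]] := below q.
  exists [set w | gelfand x w - f w < eps]; last first.
    by exists x => //; split => // w /ltW.
  have := @cvgr_lt _ _ _ _ _ _ (cg x q) eps; apply.
  by rewrite xq subrr.
Qed.

(** Completeness for the order unit norm, tested on sequences with geometric steps. The 4 is what
    [pair_complete] provides: a tail [2 * 2^-1 ^+ n] from each of two spaces. *)
Hypothesis complete : forall u : nat -> V,
  (forall n, vabs (u n.+1 - u n) <= 2^-1 ^+ n *: e) ->
  exists l, forall n, vabs (l - u n) <= (4 * 2^-1 ^+ n) *: e.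

Lemma gelfand_abs_le x (a : R) : I x -> (forall w, `|gelfand x w| <= a) ->
  vabs x <= a *: e.
Proof.
move=> Ix xa; have Iae : I (a *: e).
  by apply: principal_idealZ => //; exact: principal_ideal_self.
have ae w : gelfand (a *: e) w = a.
  by rewrite gelfandZ ?gelfand_unit ?mulr1//; exact: principal_ideal_self.
rewrite vabs_le !gelfand_le// ?ae => [|w|w]; rewrite ?ae ?gelfandN//.
- exact: principal_idealN.
- by rewrite (le_trans _ (xa w))// -normrN ler_norm.
- by rewrite (le_trans _ (xa w))// ler_norm.
Qed.

Lemma gelfand_abs_ge x (a : R) w : I x -> vabs x <= a *: e -> `|gelfand x w| <= a.
Proof.
have Ie := principal_ideal_self e0.
have mono y z : I y -> I z -> y <= z -> gelfand y w <= gelfand z w.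
  move=> Iy Iz; rewrite -vjoin_eqr => /eqP <-.
  by rewrite gelfand_vjoin// le_max lexx.
have Ia : I (a *: e) by exact: principal_idealZ.
move=> Ix; rewrite vabs_le => /andP[] /(mono _ _ Ix Ia) x1.
move=> /(mono _ _ (principal_idealN e0 Ix) Ia); move: x1.
rewrite gelfandN// gelfandZ// gelfand_unit mulr1 => x1 x2.
by rewrite ler_norml x1 lerNl x2.
Qed.

Lemma gelfand_surj (f : spectrum -> R) : continuous f ->
  exists2 x, I x & gelfand x = f.
Proof.
move=> cf.
(* With tolerance half of [2^-1 ^+ n], consecutive approximants differ by at most 3/4 of
   [2^-1 ^+ n], as [complete] demands. *)
have /choice[u uP] : forall n : nat, exists x, I x /\
    forall w, `|gelfand x w - f w| <= 2^-1 ^+ n / 2.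
  move=> n; have [|x Ix xf] := @gelfand_dense f (2^-1 ^+ n / 2) cf.
    by rewrite divr_gt0// exprn_gt0.
  by exists x.
have uI n : I (u n) by case: (uP n).
have [|l lu] := complete (u := u).
  move=> n; apply: gelfand_abs_le; first exact: principal_idealB.
  move=> w; rewrite gelfandB//.
  have [_ /(_ w) h1] := uP n; have [_ /(_ w) h2] := uP n.+1.
  rewrite (le_trans (ler_distD (f w) _ _))//.
  rewrite [X in _ + X]distrC (le_trans (lerD h2 h1))// exprS.
  have : 0 <= (2^-1 : R) ^+ n by rewrite exprn_ge0.
  lra.
have Il : I l.
  rewrite -(subrK (u 0%N) l); apply: principal_idealA => //.
  by exists (4 * 2^-1 ^+ 0); exact: lu.
exists l => //; apply/funext => w; apply/subr0_eq/eqP; rewrite -normr_le0.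
apply/ler_addgt0Pr => eps eps0; rewrite add0r.
(* The total error is [4 * 2^-1 ^+ n] from the limit plus [2^-1 ^+ n / 2] from the approximation,
   less than five times [2^-1 ^+ n]. *)
have [n neps] : exists n, (2^-1 : R) ^+ n < eps / 5.
  have h : 0 < eps / 5 by rewrite divr_gt0.
  have h2 : `|2^-1 : R| < 1 by rewrite ger0_norm; lra.
  have [n _ nP] := cvgr_lt _ (cvg_expr h2) _ h.
  by exists n; apply: nP => /=.
have := gelfand_abs_ge w (principal_idealB e0 Il (uI n)) (lu n).
rewrite gelfandB// => h1; have [_ /(_ w) h2] := uP n.
rewrite (le_trans (ler_distD (gelfand (u n) w) _ _))//.
rewrite (le_trans (lerD h1 h2))//.
have : 0 <= (2^-1 : R) ^+ n by rewrite exprn_ge0.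
lra.
Qed.

Theorem kakutani : order_unit_representation e gelfand.
Proof.
split.
- split.
  + by move=> x Ix; exact: continuous_gelfand.
  + move=> x y; rewrite !inE => Ix Iy xy.
    by apply: gelfand_inj => // w; rewrite xy.
  + by move=> f /= /gelfand_surj[x Ix <-]; exists x.
- by move=> a x y Ix Iy w; exact: gelfand_linear.
- by move=> x y Ix Iy w; rewrite gelfand_vjoin// gelfand_vmeet.
- exact: gelfand_unit.
Qed.

End KakutaniRepresentation.

(** * The class P *)

Section ClassP.
Variables (R : realType) (phi : R -> R -> R).
Hypothesis Pphi : classP phi.
Implicit Types (s t c eps : R).

(** By monotonicity the infimum is a limit as [eps] tends to 0. It only evaluates [phi] in the open
    quadrant, yet makes sense on the axes. *)
Definition phi_ext s t : R := inf [set phi (s + eps) (t + eps) | eps in [set eps | 0 < eps]].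

Lemma classP_monotone s t s' t' : 0 < s -> 0 < t -> s <= s' -> t <= t' ->
  phi s t <= phi s' t'.
Proof.
move=> s0 t0 ss tt; apply: le_trans (classP_monotone1 Pphi s0 t0 ss) _.
by apply: (classP_monotone2 Pphi) => //; exact: lt_le_trans ss.
Qed.

Lemma phi_ext_le s t eps : 0 <= s -> 0 <= t -> 0 < eps ->
  phi_ext s t <= phi (s + eps) (t + eps).
Proof.
move=> s0 t0 eps0; apply: ge_inf; last by exists eps.
by exists 0 => _ [d /= d0 <-]; apply: (classP_ge0 Pphi); exact: ltr_wpDl.
Qed.

Lemma le_phi_ext s t c :
  (forall eps, 0 < eps -> c <= phi (s + eps) (t + eps)) -> c <= phi_ext s t.
Proof.
move=> cphi; apply: lb_le_inf; first by exists (phi (s + 1) (t + 1)), 1 => //=.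
by move=> _ [eps /= eps0 <-]; exact: cphi.
Qed.

Lemma phi_ext_ge0 s t : 0 <= s -> 0 <= t -> 0 <= phi_ext s t.
Proof.
move=> s0 t0; apply: le_phi_ext => eps eps0.
by apply: (classP_ge0 Pphi); exact: ltr_wpDl.
Qed.

Lemma phi_ext_monotone s t s' t' : 0 <= s -> 0 <= t -> s <= s' -> t <= t' ->
  phi_ext s t <= phi_ext s' t'.
Proof.
move=> s0 t0 ss tt; apply: le_phi_ext => eps eps0.
apply: le_trans (phi_ext_le s0 t0 eps0) _.
by apply: classP_monotone; rewrite ?lerD2r//; exact: ltr_wpDl.
Qed.

(** Adding [d * min s t] to both variables increases them by a factor at most [1 + d], so by
    homogeneity costs at most [d * phi s t]. *)
Lemma phi_extE s t : 0 < s -> 0 < t -> phi_ext s t = phi s t.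
Proof.
move=> s0 t0; apply: le_anti; apply/andP; split; last first.
  apply: le_phi_ext => eps eps0.
  by apply: classP_monotone => //; rewrite lerDl ltW.
apply/ler_addgt0Pr => eta eta0.
have p0 := classP_ge0 Pphi s0 t0.
pose d := eta / (phi s t + 1).
have d0 : 0 < d by rewrite divr_gt0// ltr_wpDl.
have m0 : 0 < Num.min s t by rewrite lt_min s0.
apply: le_trans (phi_ext_le (ltW s0) (ltW t0) (mulr_gt0 d0 m0)) _.
apply: (@le_trans _ _ (phi ((1 + d) * s) ((1 + d) * t))).
  apply: classP_monotone; rewrite ?addr_gt0 ?(mulr_gt0 d0 m0)//.
    by rewrite mulrDl mul1r lerD2l ler_pM2l// ge_min lexx.
  by rewrite mulrDl mul1r lerD2l ler_pM2l// ge_min lexx orbT.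
rewrite (classP_homogeneous Pphi) ?addr_gt0// mulrDl mul1r lerD2l.
rewrite /d mulrAC ler_pdivrMr ?ltr_wpDl// ler_pM2l//; lra.
Qed.

Lemma phi_extZ c s t : 0 < c -> 0 <= s -> 0 <= t ->
  phi_ext (c * s) (c * t) = c * phi_ext s t.
Proof.
have le c' s' t' : 0 < c' -> 0 <= s' -> 0 <= t' ->
    phi_ext (c' * s') (c' * t') <= c' * phi_ext s' t'.
  move=> c0 s0 t0; apply: le_inf_mull => //.
    by exists (phi (s' + 1) (t' + 1)), 1 => //=.
  move=> _ [eps /= eps0 <-].
  rewrite -(classP_homogeneous Pphi) ?ltr_wpDl// !mulrDr.
  by apply: phi_ext_le; rewrite ?mulr_ge0 ?mulr_gt0// ltW.
move=> c0 s0 t0; apply: le_anti; rewrite le//=.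
have ci : 0 < c^-1 by rewrite invr_gt0.
have := le _ _ _ ci (mulr_ge0 (ltW c0) s0) (mulr_ge0 (ltW c0) t0).
by rewrite !mulrA mulVf ?gt_eqF// !mul1r ler_pdivlMl.
Qed.

(** From above, one [eps] almost attaining the infimum bounds all nearby values by monotonicity.
    From below, nearby points of the quadrant dominate (s, t) scaled by [1 - d], even when a
    coordinate is 0, and homogeneity applies. *)
Lemma phi_ext_extension : quadrant_extension phi phi_ext.
Proof.
split; last by move=> s t s0 t0; exact: phi_extE.
apply/subspace_continuousP => -[s t] /= [s0 t0].
apply/cvgrPdist_le => eta eta0; rewrite /within/=.
have [_ [eps /= eps0 <-] epsP] : exists2 r,
    [set phi (s + eps) (t + eps) | eps in [set eps | 0 < eps]] r &
    r < phi_ext s t + eta.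
  apply: inf_lt; last by rewrite ltrDl.
  by exists (phi (s + 1) (t + 1)), 1 => //=.
have p0 := phi_ext_ge0 s0 t0.
pose d := Num.min 2^-1 (eta / (phi_ext s t + 1)).
have q0 : 0 < phi_ext s t + 1 by exact: ltr_wpDl.
have d0 : 0 < d by rewrite lt_min invr_gt0 ltr0n divr_gt0.
have d1 : 0 < 1 - d.
  have : d <= 2^-1 by rewrite ge_min lexx.
  lra.
have dp : d * phi_ext s t <= eta.
  have : d <= eta / (phi_ext s t + 1) by rewrite ge_min lexx orbT.
  rewrite ler_pdivlMr// => /(le_trans _); apply.
  by rewrite ler_pM2l// lerDl.
have near_fst (P : set R) : nbhs s P -> \forall q \near ((s, t) : R * R), P q.1.
  by move=> sP; exact: (@cvg_fst _ _ (nbhs s) (nbhs t) _ P sP).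
have near_snd (P : set R) : nbhs t P -> \forall q \near ((s, t) : R * R), P q.2.
  by move=> tP; exact: (@cvg_snd _ _ (nbhs s) (nbhs t) _ P tP).
have low (r : R) : 0 <= r -> \forall r' \near r, 0 <= r' -> (1 - d) * r <= r'.
  rewrite le_eqVlt => /predU1P[<-|r0].
    apply: (@filterS R (nbhs (0 : R)) _ setT) filterT => r' _ r'0.
    by rewrite mulr0.
  have : (1 - d) * r < r by rewrite gtr_pMl//; lra.
  by move=> /lt_nbhsr; apply: filterS => r' /ltW.
have up (r : R) : \forall r' \near r, r' < r + eps / 2.
  by apply: lt_nbhsl; rewrite ltrDl divr_gt0.
suff : \forall q \near ((s, t) : R * R), 0 <= q.1 /\ 0 <= q.2 ->
    `|phi_ext s t - phi_ext q.1 q.2| <= eta by [].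
near=> q.
move=> [q1 q2]; rewrite ler_distl; apply/andP; split.
  have : phi_ext q.1 q.2 <= phi (s + eps) (t + eps).
    apply: (@le_trans _ _ (phi (q.1 + eps / 2) (q.2 + eps / 2))).
      by apply: phi_ext_le => //; rewrite divr_gt0.
    have h1 : q.1 < s + eps / 2 by near: q; exact: near_fst (up s).
    have h2 : q.2 < t + eps / 2 by near: q; exact: near_snd (up t).
    by apply: classP_monotone; lra.
  lra.
have : (1 - d) * phi_ext s t <= phi_ext q.1 q.2.
  rewrite -phi_extZ//; apply: phi_ext_monotone.
  - by rewrite mulr_ge0// ltW.
  - by rewrite mulr_ge0// ltW.
  - by apply: (_ : 0 <= q.1 -> _) => //; near: q; exact: near_fst (low s s0).
  - by apply: (_ : 0 <= q.2 -> _) => //; near: q; exact: near_snd (low t t0).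
lra.
Unshelve. all: by end_near. Qed.

(** Allows the unknown extension hidden in [functional_calculus] to be replaced by [phi_ext]. The
    comparison is made along the diagonal points (s + d, t + d), which are interior. *)
Lemma quadrant_extension_unique psi s t : quadrant_extension phi psi ->
  0 <= s -> 0 <= t -> psi s t = phi_ext s t.
Proof.
move=> [/subspace_continuousP/(_ (s, t))/= cpsi psiE] s0 t0.
have near_diag eta eps : 0 < eta -> 0 < eps -> exists2 d, 0 < d <= eps &
    `|psi s t - phi (s + d) (t + d)| <= eta.
  move=> eta0 eps0; have /cvgrPdist_le := cpsi (conj s0 t0).
  move=> /(_ eta eta0); rewrite /within/= => /nbhs_ballP[r /= r0 rP].
  pose d := Num.min eps (r / 2).
  have d0 : 0 < d by rewrite lt_min eps0 divr_gt0.
  have dr : d < r.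
    have : d <= r / 2 by rewrite ge_min lexx orbT.
    by move: r0; lra.
  exists d; first by rewrite d0 ge_min lexx.
  rewrite -psiE ?ltr_wpDl//; apply: (rP (s + d, t + d)).
    by split; rewrite /ball/= opprD addNKr normrN gtr0_norm.
  by split; apply: addr_ge0 => //; exact: ltW.
apply: le_anti; apply/andP; split.
  apply: le_phi_ext => eps eps0; apply/ler_addgt0Pr => eta eta0.
  have [d /andP[d0 deps]] := near_diag eta eps eta0 eps0.
  rewrite ler_distl => /andP[_ h]; rewrite (le_trans h)// lerD2r.
  by apply: classP_monotone; rewrite ?lerD2l ?ltr_wpDl.
apply/ler_addgt0Pr => eta eta0.
have [d /andP[d0 _]] := near_diag eta 1 eta0 ltr01.
by rewrite ler_distlC => /andP[_]; apply: le_trans; exact: phi_ext_le.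
Qed.

(** With c = min(s/u, t/v), the point c(u, v) lies below (s, t); monotonicity and homogeneity
    conclude. *)
Lemma phi_ext_min u v s t : 0 < u -> 0 < v -> 0 <= s -> 0 <= t ->
  Num.min (phi_ext u v / u * s) (phi_ext u v / v * t) <= phi_ext s t.
Proof.
move=> u0 v0 s0 t0; pose c := Num.min (s / u) (t / v).
have p0 := phi_ext_ge0 (ltW u0) (ltW v0).
have -> : Num.min (phi_ext u v / u * s) (phi_ext u v / v * t) = c * phi_ext u v.
  by rewrite [c * _]mulrC /c minr_pMr// !mulrA ![_ / _ * _]mulrAC.
have c0 : 0 <= c by rewrite le_min !divr_ge0// ltW.
move: c0; rewrite le_eqVlt => /predU1P[<-|c0].
  by rewrite mul0r; exact: phi_ext_ge0.
rewrite -phi_extZ ?(ltW u0) ?(ltW v0)//.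
apply: phi_ext_monotone; rewrite ?mulr_ge0 ?(ltW c0) ?(ltW u0) ?(ltW v0)//.
  by rewrite -ler_pdivlMr// ge_min lexx.
by rewrite -ler_pdivlMr// ge_min lexx orbT.
Qed.

Lemma phi_ext_gt0 s t : 0 < s -> 0 < t -> 0 < phi_ext s t.
Proof.
move=> s0 t0; have m0 : 0 < Num.min s t by rewrite lt_min s0.
apply: (@lt_le_trans _ _ (phi_ext (Num.min s t * 1) (Num.min s t * 1))).
  by rewrite phi_extZ// phi_extE// (classP_normalized Pphi) mulr1.
by apply: phi_ext_monotone; rewrite mulr1 ?(ltW m0)// ge_min lexx ?orbT.
Qed.

Lemma phi_ext_near_axes eta : 0 < eta -> exists2 eps, 0 < eps &
  phi_ext 1 eps <= phi_ext 1 0 + eta /\ phi_ext eps 1 <= phi_ext 0 1 + eta.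
Proof.
move=> eta0.
have near_inf s t : exists2 eps, 0 < eps & phi (s + eps) (t + eps) < phi_ext s t + eta.
  have [_ [eps /= eps0 <-] epsP] : exists2 r,
      [set phi (s + eps) (t + eps) | eps in [set eps | 0 < eps]] r &
      r < phi_ext s t + eta.
    apply: inf_lt; last by rewrite ltrDl.
    by exists (phi (s + 1) (t + 1)), 1 => //=.
  by exists eps.
have [d d0 dP] := near_inf 1 0; have [c c0 cP] := near_inf 0 1.
exists (Num.min c d); first by rewrite lt_min c0.
have m0 : 0 <= Num.min c d by rewrite le_min !ltW.
split.
  apply: le_trans (ltW dP); rewrite -phi_extE ?add0r//; last exact: addr_gt0.
  by apply: phi_ext_monotone; rewrite ?ge_min ?lexx ?orbT// lerDl ltW.
apply: le_trans (ltW cP); rewrite -phi_extE ?add0r//; last exact: addr_gt0.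
by apply: phi_ext_monotone; rewrite ?ge_min ?lexx// lerDl ltW.
Qed.

End ClassP.

(** * Merging weights into geometric sequences *)

Section Grouping.
Variable R : realType.
Implicit Types (a b c d : nat -> R).

(** Up to the crossing of [c] and [d] the terms are at most [c], which at least doubles; after it
    they are at most [d], which at least halves. Each side is a geometric sum dominated by its term
    at the crossing. *)
Lemma sum_min_geometric n c d (M : R) : 0 <= M ->
  (forall k, (k < n)%N -> 0 <= c k) -> (forall k, (k < n)%N -> 0 <= d k) ->
  (forall k, (k.+1 < n)%N -> 2 * c k <= c k.+1) ->
  (forall k, (k.+1 < n)%N -> 2 * d k.+1 <= d k) ->
  (forall k, (k < n)%N -> Num.min (c k) (d k) <= M) ->
  \sum_(k < n) Num.min (c k) (d k) <= 4 * M.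
Proof.
move=> M0 c0 d0 cS dS mM; pose m k := Num.min (c k) (d k).
have m0 k : (k < n)%N -> 0 <= m k by move=> kn; rewrite le_min c0// d0.
have sumc k : (k < n)%N -> \sum_(i < k.+1) c i <= 2 * c k.
  elim: k => [|k IH] kn; first by rewrite big_ord1; have := c0 0%N kn; lra.
  by rewrite big_ord_recr/=; have := IH (ltnW kn); have := cS k kn; lra.
have lowc k : (k < n)%N -> c k <= d k -> \sum_(i < k.+1) m i <= 2 * m k.
  move=> kn cd; rewrite [m k]min_l//; apply: le_trans (sumc k kn).
  by apply: ler_sum => i _; rewrite ge_min lexx.
(* The reserve [m k] pays for the next term on the decreasing side, where [2 * m k.+1 <= m k]. *)
suff H k : (k < n)%N -> \sum_(i < k.+1) m i <= 4 * M - m k.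
  case: n mM H m0 {c0 d0 cS dS sumc lowc} => [|n] mM H m0; first by rewrite big_ord0; lra.
  by have := H n (ltnSn n); have := m0 n (ltnSn n); rewrite /m; lra.
elim: k => [|k IH] kn.
  by rewrite big_ord1; have := mM 0%N kn; rewrite -/(m 0%N); move: M0; lra.
have mk : m k <= M := mM k (ltnW kn); have mSk : m k.+1 <= M := mM k.+1 kn.
have [cd|dc] := leP (c k.+1) (d k.+1).
  by have := lowc _ kn cd; move: M0 mSk; lra.
have mSkE : m k.+1 = d k.+1 by rewrite /m min_r// ltW.
rewrite big_ord_recr/=; have [cdk|dck] := leP (c k) (d k).
  by have := lowc k (ltnW kn) cdk; move: mk mSk; lra.
have mkE : m k = d k by rewrite /m min_r// ltW.
by have := IH (ltnW kn); have := dS k kn; rewrite mSkE mkE; lra.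
Qed.

(** Items with monotone weights [a j], [b j] are merged into consecutive groups;
    [rep k] is an item whose weights are comparable to those of group [k]. *)
Record grouping (N : nat) a b (n : nat) (alpha beta : nat -> R)
    (rep sigma : nat -> nat) : Prop := Grouping {
  grp_lt : forall j, (j < N)%N -> (sigma j < n)%N ;
  grp_a : forall j, (j < N)%N -> a j <= alpha (sigma j) ;
  grp_b : forall j, (j < N)%N -> b j <= beta (sigma j) ;
  grp_rep : forall k, (k < n)%N -> (rep k < N)%N ;
  grp_alpha : forall k, (k < n)%N -> alpha k = 2 * a (rep k) ;
  grp_beta : forall k, (k < n)%N -> 0 < beta k <= 2 * b (rep k) ;
  grp_alphaS : forall k, (k.+1 < n)%N -> 2 * alpha k <= alpha k.+1 ;
  grp_betaS : forall k, (k.+1 < n)%N -> 2 * beta k.+1 <= beta k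
}.

(** A greedy pass in which only the last group ever changes. Its [beta] is [b] of its first item;
    its [alpha] is twice [a] of a representative that is replaced whenever [a] has doubled while [b]
    is still comparable to [beta]. *)
Lemma grouping_exists N a b : (forall j, 0 < a j) -> (forall j, 0 < b j) ->
  (forall j, (j.+1 < N)%N -> a j <= a j.+1) ->
  (forall j, (j.+1 < N)%N -> b j.+1 <= b j) ->
  exists n alpha beta rep sigma, grouping N a b n alpha beta rep sigma.
Proof.
move=> a0 b0; case: N => [|N] aS bS.
  by exists 0%N, a, b, id, id; split.
(* The last item belonging to the last group gives [b N <= beta n], from which the next item is
   placed. *)
suff [n [alpha [beta [rep [sigma [G _]]]]]] :
    exists n alpha beta rep sigma,
      grouping N.+1 a b n.+1 alpha beta rep sigma /\ sigma N = n.
  by exists n.+1, alpha, beta, rep, sigma.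
elim: N aS bS => [|N IH] aS bS.
  exists 0%N, (fun=> 2 * a 0%N), (fun=> b 0%N), (fun=> 0%N), (fun=> 0%N).
  have := a0 0%N; have := b0 0%N.
  by split => //; split => // -[|j]// _; lra.
have [||n [alpha [beta [rep [sigma [G sN]]]]]] := IH.
- by move=> j jN; apply: aS; exact: ltnW.
- by move=> j jN; apply: bS; exact: ltnW.
pose upd T (f : nat -> T) k0 v k := if k == k0 then v else f k.
have updE T (f : nat -> T) k0 v : upd T f k0 v k0 = v by rewrite /upd eqxx.
have updN T (f : nat -> T) k0 v k : (k < k0)%N -> upd T f k0 v k = f k.
  by move=> kk; rewrite /upd ltn_eqF.
have aN : a N <= a N.+1 by exact: aS.
have bN : b N.+1 <= b N by exact: bS.
have bn : b N <= beta n by rewrite -sN (grp_b G).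
have [gl ga gb gr gal gbe gaS gbS] := G.
have lastP (P : nat -> Prop) (m : nat) : (forall j, (j < m)%N -> P j) -> P m ->
    forall j, (j < m.+1)%N -> P j.
  by move=> Pm PM j; rewrite ltnS leq_eqVlt => /predU1P[->|/Pm].
(* The factor 2 in [alpha n = 2 * a (rep n)] is the slack that absorbs this item. *)
have [small|big] := ltP (a N.+1) (2 * a (rep n)).
  exists n, alpha, beta, rep, (upd _ sigma N.+1 n); split; last by rewrite updE.
  split => //.
  - by apply: lastP => [j jN|]; rewrite ?updE ?updN//; exact: gl.
  - apply: lastP => [j jN|]; first by rewrite updN// ga.
    by rewrite updE gal// ltW.
  - apply: lastP => [j jN|]; first by rewrite updN// gb.
    by rewrite updE; exact: le_trans bN bn.
  - by move=> k kn; rewrite (leq_trans (gr _ kn)).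
have aSN := a0 N.+1.
(* If [a] has doubled but [b] is still at least half of [beta n], the item becomes the
   representative; raising the last [alpha] keeps the doubling. *)
have [keep|drop] := leP (beta n) (2 * b N.+1).
  exists n, (upd _ alpha n (2 * a N.+1)), beta, (upd _ rep n N.+1),
    (upd _ sigma N.+1 n); split; last by rewrite updE.
  have le_alpha : forall k, (k < n.+1)%N -> alpha k <= upd _ alpha n (2 * a N.+1) k.
    apply: lastP => [j jn|]; first by rewrite updN.
    by rewrite updE gal//; move: big aSN; lra.
  split.
  - by apply: lastP => [j jN|]; rewrite ?updE ?updN//; exact: gl.
  - apply: lastP => [j jN|]; last by rewrite !updE; lra.
    by rewrite (updN _ sigma)// (le_trans (ga _ jN))// le_alpha// gl.
  - apply: lastP => [j jN|]; last by rewrite !updE; exact: le_trans bN bn.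
    by rewrite (updN _ sigma)// gb.
  - apply: lastP => [j jn|]; last by rewrite !updE.
    by rewrite updN// ltnW// ltnS gr// ltnW.
  - apply: lastP => [j jn|]; last by rewrite !updE.
    by rewrite !updN// gal// ltnW.
  - apply: lastP => [j jn|]; last by rewrite updE keep andbT; case/andP: (gbe n (ltnSn n)).
    by rewrite updN// gbe// ltnW.
  - move=> k kn; rewrite (updN _ alpha)//; apply: le_trans (gaS k kn) _.
    exact: le_alpha.
  - exact: gbS.
(* Both weights have moved by a factor 2, so a group opens. It satisfies the doubling since [2 *
   alpha n = 4 * a (rep n) <= 2 * a N.+1]. *)
exists n.+1, (upd _ alpha n.+1 (2 * a N.+1)), (upd _ beta n.+1 (b N.+1)),
  (upd _ rep n.+1 N.+1), (upd _ sigma N.+1 n.+1); split; last by rewrite updE.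
have bSN := b0 N.+1.
split.
- by apply: lastP => [j jN|]; rewrite ?updE ?updN// ltnW// ltnS gl.
- apply: lastP => [j jN|]; last by rewrite !updE; lra.
  by rewrite (updN _ sigma)// updN ?gl// ga.
- apply: lastP => [j jN|]; last by rewrite !updE.
  by rewrite (updN _ sigma)// updN ?gl// gb.
- apply: lastP => [j jn|]; last by rewrite !updE.
  by rewrite updN// ltnW// ltnS gr.
- apply: lastP => [j jn|]; last by rewrite !updE.
  by rewrite !updN// gal.
- apply: lastP => [j jn|]; last by rewrite !updE bSN/=; lra.
  by rewrite !updN// gbe.
- move=> k; rewrite ltnS; move: k; apply: lastP => [j jn|].
    by rewrite !updN// ?gaS// ltnW.
  by rewrite updE updN// gal//; move: big; lra.
- move=> k; rewrite ltnS; move: k; apply: lastP => [j jn|].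
    by rewrite !updN// ?gbS// ltnW.
  by rewrite updE updN//; move: drop; lra.
Qed.

End Grouping.

(** * A partition of unity adapted to phi *)

Section Discretization.
Variable R : realType.
Implicit Types (s t y eta delta : R).

Lemma sumr_telescope (f : nat -> R) n :
  \sum_(j < n) (f j - f j.+1) = f 0%N - f n.
Proof.
elim: n => [|n IH]; first by rewrite big_ord0 subrr.
by rewrite big_ord_recr/= IH; ring.
Qed.

Lemma continuous_sumr (T : topologicalType) n (F : nat -> T -> R) :
  (forall j, continuous (F j)) -> continuous (fun x => \sum_(j < n) F j x).
Proof.
move=> cF; elim: n => [|n IH] x.
  rewrite (_ : (fun x => _) = (fun=> 0)); first exact: cvg_cst.
  by apply/funext => z; rewrite big_ord0.
rewrite (_ : (fun x => _) = (fun x => \sum_(j < n) F j x + F n x)).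
  exact: cvgD (IH x) (cF n x).
by apply/funext => z; rewrite big_ord_recr.
Qed.

(** Climbs from 0 to 1 between [i * delta] and [(i + 1) * delta]. Differences of consecutive ramps
    are tents, whose sum telescopes. *)
Definition ramp delta (i : nat) y : R := Num.min 1 (Num.max 0 (y / delta - i%:R)).

Lemma continuous_ramp delta i : continuous (ramp delta i).
Proof.
move=> y.
have h : {for y, continuous (fun y => y / delta - i%:R)}.
  exact: cvgB (cvgM cvg_id (cvg_cst _)) (cvg_cst _).
have c (a z : R) : {for z, continuous (fun _ : R => a)} by exact: cvg_cst.
exact: (@continuous_min R R (fun=> 1) _ y (c 1 y)
  (@continuous_max R R (fun=> 0) _ y (c 0 y) h)).
Qed.

Lemma ramp_ge0 delta i y : 0 <= ramp delta i y.
Proof. by rewrite le_min ler01 le_max lexx. Qed.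

Lemma ramp_le1 delta i y : ramp delta i y <= 1.
Proof. by rewrite ge_min lexx. Qed.

Lemma ramp_nincr delta i y : ramp delta i.+1 y <= ramp delta i y.
Proof.
have h : y / delta - i.+1%:R <= y / delta - i%:R.
  by rewrite lerD2l lerN2 ler_nat.
by rewrite /ramp; case: (leP 0 (y / delta - i.+1%:R)) => h1;
  case: (leP 0 (y / delta - i%:R)) => h2; rewrite ?le_min ?ge_min; move: h h1 h2;
  case: (leP 1 (y / delta - i.+1%:R)); case: (leP 1 (y / delta - i%:R));
  rewrite ?lexx ?ler01 ?orbT//; lra.
Qed.

Lemma ramp_eq0 delta i y : 0 < delta -> y <= i%:R * delta -> ramp delta i y = 0.
Proof.
move=> d0; rewrite -ler_pdivrMr// -subr_le0 => yi.
by rewrite /ramp max_l// min_r.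
Qed.

Lemma ramp_eq1 delta i y : 0 < delta -> i.+1%:R * delta <= y -> ramp delta i y = 1.
Proof.
move=> d0; rewrite -ler_pdivlMr// -natr1 -lerBrDl => yi.
by rewrite /ramp min_l// le_max yi orbT.
Qed.

(** Pieces of a partition of unity in the variable [y = 1 + t - s], which
    parametrizes the pairs [(s, t)] of nonnegative reals with maximum [1]. *)
Record discretization (psi : R -> R -> R) eta (n : nat) (alpha beta : nat -> R)
    (lft rgt : R -> R) (mid : nat -> R -> R) : Prop := Discretization {
  dsc_cont_lft : continuous lft ;
  dsc_cont_rgt : continuous rgt ;
  dsc_cont_mid : forall k, continuous (mid k) ;
  dsc_lft_ge0 : forall y, 0 <= lft y ;
  dsc_rgt_ge0 : forall y, 0 <= rgt y ;
  dsc_mid_ge0 : forall k y, 0 <= mid k y ;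
  dsc_sum : forall y, lft y + rgt y + \sum_(k < n) mid k y = 1 ;
  dsc_lft_le : forall s t, 0 <= s -> 0 <= t -> Num.max s t = 1 ->
    lft (1 + t - s) * psi s t <= lft (1 + t - s) * ((psi 1 0 + eta) * s) ;
  dsc_rgt_le : forall s t, 0 <= s -> 0 <= t -> Num.max s t = 1 ->
    rgt (1 + t - s) * psi s t <= rgt (1 + t - s) * ((psi 0 1 + eta) * t) ;
  dsc_alpha_le : forall k s t, (k < n)%N -> 0 <= s -> 0 <= t -> Num.max s t = 1 ->
    mid k (1 + t - s) * psi s t <= mid k (1 + t - s) * (4 * alpha k * s) ;
  dsc_beta_le : forall k s t, (k < n)%N -> 0 <= s -> 0 <= t -> Num.max s t = 1 ->
    mid k (1 + t - s) * psi s t <= mid k (1 + t - s) * (4 * beta k * t) ;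
  dsc_alpha_gt0 : forall k, (k < n)%N -> 0 < alpha k ;
  dsc_beta_gt0 : forall k, (k < n)%N -> 0 < beta k ;
  dsc_sum_min : forall s t, 0 <= s -> 0 <= t ->
    \sum_(k < n) Num.min (alpha k * s) (beta k * t) <= 8 * psi s t
}.

Variable phi : R -> R -> R.
Hypothesis Pphi : classP phi.
Local Notation psi := (phi_ext phi).

(** By homogeneity psi(u, v)/u is psi(1, v/u), which grows with v/u, while psi(u, v)/v is psi(u/v,
    1), which decreases. So the weights are monotone along the grid, as grouping requires. *)
Lemma phi_ext_slope u v u' v' : 0 < u' -> u' <= u -> 0 < v -> v <= v' ->
  psi u v / u <= psi u' v' / u' /\ psi u' v' / v' <= psi u v / v.
Proof.
move=> u'0 uu v0 vv; have u0 := lt_le_trans u'0 uu; have v'0 := lt_le_trans v0 vv.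
split.
  have -> : psi u v / u = u' / u * psi u v / u' by field; rewrite !gt_eqF.
  rewrite ler_pM2r ?invr_gt0//.
  have c0 : 0 < u' / u by rewrite divr_gt0.
  rewrite -phi_extZ// ?(ltW u0) ?(ltW v0)// divfK ?gt_eqF//.
  apply: phi_ext_monotone => //; rewrite ?(ltW u'0) ?(mulr_ge0 (ltW c0)) ?(ltW v0) ?(ltW u'0)//.
  by rewrite (le_trans _ vv)// ler_piMl ?(ltW v0) ?(ltW u'0)// ler_pdivrMr// mul1r.
have -> : psi u' v' / v' = v / v' * psi u' v' / v by field; rewrite !gt_eqF.
rewrite ler_pM2r ?invr_gt0//.
have c0 : 0 < v / v' by rewrite divr_gt0.
rewrite -phi_extZ// ?(ltW u'0) ?(ltW v'0)// divfK ?gt_eqF//.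
apply: phi_ext_monotone => //; rewrite ?(ltW u'0) ?(mulr_ge0 (ltW c0)) ?(ltW v0) ?(ltW u'0)//.
by rewrite (le_trans _ uu)// ler_piMl ?(ltW v0) ?(ltW u'0)// ler_pdivrMr// mul1r.
Qed.

Lemma phi_ext_comparable u v s t : 0 < u -> 0 < v -> 0 <= s -> 0 <= t ->
  s <= 2 * u -> t <= 2 * v -> u <= 2 * s -> v <= 2 * t ->
  psi s t <= 4 * (psi u v / u) * s /\ psi s t <= 4 * (psi u v / v) * t.
Proof.
move=> u0 v0 s0 t0 su tv us vt.
have p0 := phi_ext_ge0 Pphi (ltW u0) (ltW v0).
have h : psi s t <= 2 * psi u v.
  by rewrite -phi_extZ ?(ltW u0) ?(ltW v0)//; exact: phi_ext_monotone.
have a0 : 0 <= psi u v / u by rewrite divr_ge0// ltW.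
have b0 : 0 <= psi u v / v by rewrite divr_ge0// ltW.
have ua : psi u v = psi u v / u * u by rewrite divfK// gt_eqF.
have vb : psi u v = psi u v / v * v by rewrite divfK// gt_eqF.
split; apply: (le_trans h); [rewrite {1}ua|rewrite {1}vb].
  by have := ler_wpM2l a0 us; lra.
by have := ler_wpM2l b0 vt; lra.
Qed.

Lemma max_eq1 s t : Num.max s t = 1 -> (s = 1 /\ t <= 1) \/ (t = 1 /\ s <= 1).
Proof.
by case: (leP s t) => [st <-|/ltW st <-]; [right|left].
Qed.

(** On [max s t = 1] one has s = min(1, 2 - y) and t = min(1, y) with y = 1 + t - s. Here (u, v) is
    the point with parameter [p + 2 * delta], the centre of a tent. On the tent, [y] is within
    [delta] of the centre and more than [delta] away from 0 and 2, so coordinates change by a factor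
    at most 2. *)
Lemma grid_comparable delta p q s t : 0 < delta -> q + 3 * delta = 2 ->
  p + delta <= q -> 0 <= p -> 2 * delta <= 1 -> 0 <= s -> 0 <= t ->
  (s = 1 /\ t <= 1) \/ (t = 1 /\ s <= 1) ->
  p + delta < 1 + t - s -> 1 + t - s < p + 3 * delta ->
  let u := Num.min 1 (q - p + delta) in let v := Num.min 1 (p + 2 * delta) in
  [/\ s <= 2 * u, t <= 2 * v, u <= 2 * s & v <= 2 * t].
Proof.
move=> d0 qE pq p0 d1 s0 t0 st y1 y3 u v.
have u1 : u <= 1 by rewrite ge_min lexx.
have u2 : u <= q - p + delta by rewrite ge_min lexx orbT.
have u3 : u = 1 \/ u = q - p + delta by rewrite /u; case: leP => _; [left|right].
have v1 : v <= 1 by rewrite ge_min lexx.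
have v2 : v <= p + 2 * delta by rewrite ge_min lexx orbT.
have v3 : v = 1 \/ v = p + 2 * delta by rewrite /v; case: leP => _; [left|right].
clearbody u v; have qE' : q = 2 - 3 * delta by lra.
subst q; clear phi Pphi qE.
by case: st => -[? ?]; subst; case: u3 => ?; case: v3 => ?; subst; split; lra.
Qed.

Lemma discretization_exists eta : 0 < eta ->
  exists n alpha beta lft rgt mid, discretization psi eta n alpha beta lft rgt mid.
Proof.
move=> eta0; have [eps eps0 [near0 near1]] := phi_ext_near_axes Pphi eta0.
(* The range [0, 2] of [y] is cut into N + 3 cells: [N] tents centred at the points
   [(j + 2) * delta], and at each end an extreme piece living on two cells, within [eps] of the
   end. *)
have [N [delta [d0 dN d1 deps]]] : exists (N : nat) delta, [/\ 0 < delta,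
    N%:R * delta + 3 * delta = 2, 2 * delta <= 1 & 2 * delta <= eps].
  pose m := Num.min eps 1; have m0 : 0 < m by rewrite lt_min eps0 ltr01.
  pose N := Num.bound (4 / m); exists N, (2 / N.+3%:R).
  have NE : N.+3%:R = N%:R + 3 :> R by rewrite -(addn3 N) natrD.
  have N3 : 0 < N.+3%:R :> R by [].
  have : 4 / m < N%:R by apply: archi_boundP; rewrite divr_ge0// ltW.
  rewrite ltr_pdivrMr// => Nm.
  have dm : 2 * (2 / N.+3%:R) <= m.
    by rewrite mulrA ler_pdivrMr// NE; move: Nm m0; lra.
  split; first exact: divr_gt0.
  - by rewrite -mulrDl -NE mulrC divfK// gt_eqF.
  - by apply: (le_trans dm); rewrite ge_min lexx orbT.
  - by apply: (le_trans dm); rewrite ge_min lexx.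
(* Grid points at the tent centres: [(N - j).+1 * delta] is [2 - (j + 2) * delta]. *)
pose u (j : nat) := Num.min 1 ((N - j).+1%:R * delta).
pose v (j : nat) := Num.min 1 (j.+2%:R * delta).
have u0 j : 0 < u j by rewrite lt_min ltr01 mulr_gt0.
have v0 j : 0 < v j by rewrite lt_min ltr01 mulr_gt0.
have p0 j : 0 < psi (u j) (v j) by exact: phi_ext_gt0.
pose a j := psi (u j) (v j) / u j; pose b j := psi (u j) (v j) / v j.
have slope j : a j <= a j.+1 /\ b j.+1 <= b j.
  apply: phi_ext_slope => //.
    rewrite /u le_min ge_min lexx/= ge_min; apply/orP; right.
    by rewrite ler_pM2r// ler_nat ltnS leq_sub2l.
  rewrite /v le_min ge_min lexx/= ge_min; apply/orP; right.
  by rewrite ler_pM2r// ler_nat.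
have [||j _|j _|n [alpha [beta [rep [sigma G]]]]] :=
    @grouping_exists R N a b; try by move=> j; rewrite divr_gt0.
- by case: (slope j).
- by case: (slope j).
pose theta j y := ramp delta j.+1 y - ramp delta j.+2 y.
have theta_ge0 j y : 0 <= theta j y by rewrite subr_ge0 ramp_nincr.
have supp j s t : (j < N)%N -> 0 <= s -> 0 <= t -> Num.max s t = 1 ->
    theta j (1 + t - s) = 0 \/
    (psi s t <= 4 * a j * s /\ psi s t <= 4 * b j * t).
  move=> jN s0 t0 /max_eq1 st; set y := 1 + t - s.
  have [ylow|ylow] := leP y (j.+1%:R * delta).
    left; rewrite /theta !ramp_eq0 ?subrr// (le_trans ylow)//.
    by rewrite ler_pM2r// ler_nat.
  have [yup|yup] := leP (j.+3%:R * delta) y.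
    left; rewrite /theta !ramp_eq1 ?subrr// (le_trans _ yup)//.
    by rewrite ler_pM2r// ler_nat.
  right; pose p := j%:R * delta; pose q := N%:R * delta.
  have jE k : (j + k)%N%:R * delta = p + k%:R * delta by rewrite natrD mulrDl.
  have y1 : p + delta < y by move: ylow; rewrite -addn1 jE mul1r.
  have y3 : y < p + 3 * delta by move: yup; rewrite -(addn3 j) jE.
  have pq : p + delta <= q.
    have -> : p + delta = (j + 1)%:R * delta by rewrite jE mul1r.
    by rewrite addn1 ler_pM2r// ler_nat.
  have p_ge0 : 0 <= p by rewrite mulr_ge0// ltW.
  have qE : q + 3 * delta = 2 by [].
  have uE : u j = Num.min 1 (q - p + delta).
    by rewrite /u -natr1 natrB ?(ltnW jN)// mulrDl mulrBl mul1r.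
  have vE : v j = Num.min 1 (p + 2 * delta) by rewrite /v -addn2 jE.
  rewrite /y in y1 y3; clearbody p q; clear dN deps.
  have [] := grid_comparable d0 qE pq p_ge0 d1 s0 t0 st y1 y3.
  by rewrite -uE -vE => *; exact: phi_ext_comparable.
pose mid k y := \sum_(j < N) (if sigma j == k then theta j y else 0).
exists n, alpha, beta, (fun y => 1 - ramp delta 1 y), (ramp delta N.+1), mid.
have mid_le k (f g : R) y :
    (forall j, (j < N)%N -> sigma j = k -> theta j y * f <= theta j y * g) ->
    mid k y * f <= mid k y * g.
  move=> fg; rewrite !mulr_suml; apply: ler_sum => j _.
  by case: eqP => [jk|_]; [exact: fg|rewrite !mul0r].
have rep_gt0 j : 0 < a j by rewrite divr_gt0.
have beta_gt0 k : (k < n)%N -> 0 < beta k by move=> /(grp_beta G)/andP[].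
have alpha_gt0 k : (k < n)%N -> 0 < alpha k.
  by move=> /(grp_alpha G) ->; have := rep_gt0 (rep k); lra.
split => //.
- move=> y; exact: cvgB (cvg_cst _) (continuous_ramp (x := y)).
- exact: continuous_ramp.
- move=> k; apply: (@continuous_sumr R N
    (fun j y => if sigma j == k then theta j y else 0)) => j y.
  case: (sigma j == k); last exact: cvg_cst.
  exact: cvgB (continuous_ramp (x := y)) (continuous_ramp (x := y)).
- by move=> y; rewrite subr_ge0 ramp_le1.
- by move=> y; exact: ramp_ge0.
- by move=> k y; apply: sumr_ge0 => j _; case: ifP.
- move=> y; rewrite exchange_big/=.
  rewrite (eq_bigr (fun j : 'I_N => ramp delta j.+1 y - ramp delta j.+2 y)).
    by rewrite (sumr_telescope (fun j => ramp delta j.+1 y)); ring.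
  move=> j _; have jn := grp_lt G (ltn_ord j).
  rewrite (bigD1 (Ordinal jn))//= eqxx big1 ?addr0// => k.
  by rewrite -val_eqE/= eq_sym => /negbTE ->.
- move=> s t s0 t0 st; have [y2|y2] := leP (2 * delta) (1 + t - s).
    by rewrite ramp_eq1// subrr !mul0r.
  have [s1 t1] : s = 1 /\ t <= eps by case: (max_eq1 st) => -[? ?]; split; lra.
  rewrite ler_wpM2l// ?subr_ge0 ?ramp_le1// s1 mulr1 (le_trans _ near0)//.
  exact: phi_ext_monotone.
- move=> s t s0 t0 st; have [y2|y2] := leP (1 + t - s) (N.+1%:R * delta).
    by rewrite ramp_eq0// !mul0r.
  have y2' : 2 - 2 * delta < 1 + t - s.
    by move: y2; rewrite -natr1 mulrDl mul1r; lra.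
  have [t1 s1] : t = 1 /\ s <= eps by case: (max_eq1 st) => -[? ?]; split; lra.
  rewrite ler_wpM2l// ?ramp_ge0// t1 mulr1 (le_trans _ near1)//.
  exact: phi_ext_monotone.
- move=> k s t kn s0 t0 st; apply: mid_le => j jN jk.
  have [->|[h _]] := supp j s t jN s0 t0 st; first by rewrite !mul0r.
  rewrite ler_wpM2l// (le_trans h)// ler_wpM2r// ler_pM2l//.
  by rewrite -jk (grp_a G).
- move=> k s t kn s0 t0 st; apply: mid_le => j jN jk.
  have [->|[_ h]] := supp j s t jN s0 t0 st; first by rewrite !mul0r.
  rewrite ler_wpM2l// (le_trans h)// ler_wpM2r// ler_pM2l//.
  by rewrite -jk (grp_b G).
(* 8 = 4 * 2: [alpha] and [beta] are at most twice the weights of the representative, so by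
   [phi_ext_min] each minimum is at most [2 * psi s t], and the geometric sum costs a factor 4. *)
- move=> s t s0 t0.
  have -> : 8 * psi s t = 4 * (2 * psi s t) by ring.
  apply: (@sum_min_geometric _ n (fun k => alpha k * s) (fun k => beta k * t)).
  + by have := phi_ext_ge0 Pphi s0 t0; lra.
  + by move=> k kn; rewrite mulr_ge0// ltW// alpha_gt0.
  + by move=> k kn; rewrite mulr_ge0// ltW// beta_gt0.
  + by move=> k kn; rewrite mulrA ler_wpM2r// (grp_alphaS G).
  + by move=> k kn; rewrite mulrA ler_wpM2r// (grp_betaS G).
  + move=> k kn; have := phi_ext_min Pphi (u0 (rep k)) (v0 (rep k)) s0 t0.
    rewrite -/(a (rep k)) -/(b (rep k)) => h.
    apply: (@le_trans _ _ (2 * Num.min (a (rep k) * s) (b (rep k) * t))).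
      have hb : beta k * t <= 2 * (b (rep k) * t).
        by rewrite mulrA ler_wpM2r//; case/andP: (grp_beta G kn).
      have ha : alpha k * s <= 2 * (a (rep k) * s) by rewrite (grp_alpha G)// mulrA.
      by rewrite minr_pMr// le_min !ge_min ha hb orbT.
    by rewrite ler_pM2l.
Qed.

End Discretization.

(** * Functional calculus in an ideal with an order unit *)

Section OrderUnitRepresentation.
Variables (R : realType) (V : vectorLatticeType R) (e : V).
Variables (Omega : topologicalType) (h : V -> Omega -> R).
Hypothesis e0 : 0 <= e.
Hypothesis hP : order_unit_representation e h.
Local Notation I := (principal_ideal e).
Implicit Types (x y : V) (w : Omega) (a : R).

Lemma our_linear a x y w : I x -> I y -> h (a *: x + y) w = a * h x w + h y w.
Proof. by case: hP => _ + _ _ Ix Iy; apply. Qed.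

Lemma our_vjoin x y w : I x -> I y -> h (vjoin x y) w = Num.max (h x w) (h y w).
Proof. by case: hP => _ _ + _ Ix Iy => /(_ x y Ix Iy w)[]. Qed.

Lemma our_vmeet x y w : I x -> I y -> h (vmeet x y) w = Num.min (h x w) (h y w).
Proof. by case: hP => _ _ + _ Ix Iy => /(_ x y Ix Iy w)[]. Qed.

Lemma our_unit w : h e w = 1.
Proof. by case: hP. Qed.

Lemma our_inj x y : I x -> I y -> (forall w, h x w = h y w) -> x = y.
Proof.
case: hP => -[_ hinj _] _ _ _ Ix Iy xy; apply: hinj; rewrite ?inE//.
exact/funext.
Qed.

Lemma our_surj (f : Omega -> R) : continuous f -> exists2 x, I x & forall w, h x w = f w.
Proof. by case: hP => -[_ _ hs] _ _ _ /hs[x Ix <-]; exists x. Qed.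

Lemma our_continuous x : I x -> continuous (h x).
Proof. by case: hP => -[hf _ _] _ _ _; exact: hf. Qed.

Lemma our0 w : h 0 w = 0.
Proof.
have I0 := principal_ideal0 e.
by have := our_linear 1 w I0 I0; rewrite scaler0 addr0; lra.
Qed.

Lemma ourZ a x w : I x -> h (a *: x) w = a * h x w.
Proof.
by move=> Ix; have := our_linear a w Ix (principal_ideal0 e); rewrite !addr0 our0 addr0.
Qed.

Lemma ourD x y w : I x -> I y -> h (x + y) w = h x w + h y w.
Proof. by move=> Ix Iy; rewrite -[x]scale1r our_linear// scale1r mul1r. Qed.

Lemma ourN x w : I x -> h (- x) w = - h x w.
Proof. by move=> Ix; rewrite -scaleN1r ourZ// mulN1r. Qed.

Lemma our_vabs x w : I x -> h (vabs x) w = `|h x w|.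
Proof.
move=> Ix; rewrite our_vjoin ?ourN//; last exact: principal_idealN.
by rewrite maxrN.
Qed.

Lemma principal_ideal_sum n (f : nat -> V) :
  (forall k, (k < n)%N -> I (f k)) -> I (\sum_(k < n) f k).
Proof.
move=> If; elim/big_ind: _ => [|x y|k _]; first exact: principal_ideal0.
  exact: principal_idealA.
exact: If.
Qed.

Lemma our_sum n (f : nat -> V) w : (forall k, (k < n)%N -> I (f k)) ->
  h (\sum_(k < n) f k) w = \sum_(k < n) h (f k) w.
Proof.
elim: n => [|n IH] If; first by rewrite !big_ord0 our0.
have IfS k : (k < n)%N -> I (f k) by move=> kn; apply: If; exact: ltnW.
rewrite !big_ord_recr/= ourD ?IH//; first exact: principal_ideal_sum.
exact: If.
Qed.

Lemma our_le x y : I x -> I y -> (x <= y) <-> (forall w, h x w <= h y w).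
Proof.
move=> Ix Iy; split=> [|xy].
  by rewrite -vjoin_eqr => /eqP <- w; rewrite our_vjoin// le_max lexx.
rewrite -vjoin_eqr; apply/eqP; apply: our_inj => // [|w].
  exact: principal_ideal_vjoin.
by rewrite our_vjoin// max_r.
Qed.

Lemma our_ge0 x w : I x -> 0 <= x -> 0 <= h x w.
Proof.
move=> Ix x0; rewrite -(our0 w).
exact: (our_le (principal_ideal0 e) Ix).1.
Qed.

Lemma our_vabs_le x y w : I x -> I y -> vabs x <= y -> `|h x w| <= h y w.
Proof.
move=> Ix Iy; rewrite -our_vabs// => /our_le; apply => //.
exact: principal_ideal_vabs.
Qed.

End OrderUnitRepresentation.

Section ScaledCalculus.
Variables (R : realType) (V : vectorLatticeType R) (phi : R -> R -> R).

(** The generated ideal and [Omega] stay the same; the representation is precomposed with division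
    by [c]. *)
Lemma functional_calculus_scale (c : R) (x0 x1 z : V) : 0 < c ->
  functional_calculus phi x0 x1 z ->
  functional_calculus phi (c *: x0) (c *: x1) (c *: z).
Proof.
move=> c0 [psi [K [h [psiP KP hP [a za] hz]]]].
have ci : 0 < c^-1 by rewrite invr_gt0.
have cc : c^-1 * c = 1 by rewrite mulVf// gt_eqF.
have IE : principal_ideal (vjoin (c *: x0) (c *: x1)) = principal_ideal (vjoin x0 x1).
  rewrite vjoinZ//; apply/seteqP; split => x [b xb].
    by exists (b * c); rewrite -scalerA.
  by exists (b * c^-1); rewrite scalerA -mulrA cc mulr1.
exists psi, K, (fun x w => h (c^-1 *: x) w); split => //.
- case: hP => -[hf hi hs] hl hj he; rewrite /order_unit_representation IE vjoinZ//.
  have scI x : principal_ideal (vjoin x0 x1) x ->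
      principal_ideal (vjoin x0 x1) (c^-1 *: x).
    move=> [b xb]; exists (c^-1 * b); rewrite vabsZ gtr0_norm// -scalerA.
    by rewrite vlerZ_pos.
  have scI' x : principal_ideal (vjoin x0 x1) x ->
      principal_ideal (vjoin x0 x1) (c *: x).
    move=> [b xb]; exists (c * b); rewrite vabsZ gtr0_norm// -scalerA.
    by rewrite vlerZ_pos.
  split.
  + split.
    * by move=> x /scI; exact: hf.
    * move=> x y; rewrite !inE => /scI Ix /scI Iy /= xy.
      have := hi (c^-1 *: x) (c^-1 *: y); rewrite !inE => /(_ Ix Iy xy).
      by move=> /(congr1 ( *:%R c)); rewrite !scalerA divff ?gt_eqF// !scale1r.
    * move=> f /hs[x Ix <-]; exists (c *: x); first exact: scI'.
      by apply/funext => w; rewrite scalerA cc scale1r.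
  + move=> b x y /scI Ix /scI Iy w.
    by rewrite scalerDr scalerA mulrC -scalerA hl.
  + move=> x y /scI Ix /scI Iy w; rewrite -vjoinZ// vmeetE scalerN -vjoinZ//.
    by rewrite !scalerN -vmeetE; exact: hj.
  + by move=> w; rewrite scalerA cc scale1r.
- exists a; rewrite vjoinZ// vabsZ gtr0_norm// scalerA mulrC -scalerA.
  by rewrite vlerZ_pos.
- by move=> w; rewrite !scalerA cc !scale1r hz.
Qed.

End ScaledCalculus.

Section CalculusBound.
Variables (R : realType) (V : vectorLatticeType R) (phi : R -> R -> R).
Hypothesis Pphi : classP phi.
Local Notation psi := (phi_ext phi).

Lemma phi_ext_axes s t : 0 <= s -> 0 <= t ->
  psi 1 0 * s <= psi s t /\ psi 0 1 * t <= psi s t.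
Proof.
have p10 := phi_ext_ge0 Pphi ler01 (lexx 0).
have p01 := phi_ext_ge0 Pphi (lexx 0) ler01.
move=> s0 t0; split.
  move: (s0); rewrite le_eqVlt => /predU1P[<-|s_gt0].
    by rewrite mulr0; exact: phi_ext_ge0.
  rewrite mulrC -phi_extZ// ?ler01//; apply: phi_ext_monotone;
    by rewrite ?mulr1 ?mulr0.
move: (t0); rewrite le_eqVlt => /predU1P[<-|t_gt0].
  by rewrite mulr0; exact: phi_ext_ge0.
rewrite mulrC -phi_extZ// ?ler01//; apply: phi_ext_monotone;
  by rewrite ?mulr1 ?mulr0.
Qed.

(** Each [q k] is below the meet of its two bounds, and on [Omega] the claim becomes a scalar
    inequality: one psi(s, t) for each axis term by [phi_ext_axes], and 8 for the sum of minima. *)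
Lemma functional_calculus_ge (x0 x1 z pl pr : V) n (q : nat -> V)
    (alpha beta : nat -> R) : 0 <= x0 -> 0 <= x1 ->
  functional_calculus phi x0 x1 z ->
  vabs pl <= psi 1 0 *: x0 -> vabs pr <= psi 0 1 *: x1 ->
  (forall k, (k < n)%N -> vabs (q k) <= alpha k *: x0) ->
  (forall k, (k < n)%N -> vabs (q k) <= beta k *: x1) ->
  (forall s t, 0 <= s -> 0 <= t ->
     \sum_(k < n) Num.min (alpha k * s) (beta k * t) <= 8 * psi s t) ->
  vabs (pl + pr + \sum_(k < n) q k) <= 10 *: z.
Proof.
move=> x0_ge0 x1_ge0 [psi' [K [h [psiP _ hP Iz hz]]]] plx prx qx0 qx1 sum_min.
set e := vjoin x0 x1 in hP Iz *.
have e0 : 0 <= e by exact: vjoin_ge0.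
have Ix0 : principal_ideal e x0.
  by apply: principal_ideal_itv; rewrite x0_ge0 vjoin_lel.
have Ix1 : principal_ideal e x1.
  by apply: principal_ideal_itv; rewrite x1_ge0 vjoin_ler.
have IZ a x : principal_ideal e x -> principal_ideal e (a *: x).
  exact: principal_idealZ.
pose m k := vmeet (alpha k *: x0) (beta k *: x1).
have Im k : principal_ideal e (m k) by apply: principal_ideal_vmeet => //; exact: IZ.
have Isum : principal_ideal e (\sum_(k < n) m k) by exact: principal_ideal_sum.
have Iaxes : principal_ideal e (psi 1 0 *: x0 + psi 0 1 *: x1).
  by apply: principal_idealA => //; exact: IZ.
apply: (@le_trans _ _ (psi 1 0 *: x0 + psi 0 1 *: x1 + \sum_(k < n) m k)).
  rewrite (le_trans (vabsD _ _))// vlerD//.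
    by rewrite (le_trans (vabsD _ _))// vlerD.
  rewrite (le_trans (vabs_sum _))//; apply: vler_sum => k.
  by apply: vmeet_glb; [exact: qx0|exact: qx1].
apply/(our_le e0 hP); [exact: principal_idealA|exact: IZ|move=> w].
have s0 : 0 <= h x0 w by exact: (our_ge0 e0 hP).
have t0 : 0 <= h x1 w by exact: (our_ge0 e0 hP).
rewrite !(ourD hP)//; try exact: IZ.
rewrite !(ourZ hP)// (our_sum e0 hP)// hz.
rewrite (quadrant_extension_unique Pphi psiP)//.
have -> : \sum_(k < n) h (m k) w =
    \sum_(k < n) Num.min (alpha k * h x0 w) (beta k * h x1 w).
  apply: eq_bigr => k _.
  by rewrite (our_vmeet hP) ?(ourZ hP)//; exact: IZ.
have [h1 h2] := phi_ext_axes s0 t0; have h3 := sum_min _ _ s0 t0.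
by move: h1 h2 h3; lra.
Qed.

End CalculusBound.

(** * Quasi-Banach lattices *)

Section QuasiBanach.
Variables (R : realType) (E : quasiBanachLatticeType R).
Implicit Types (x y l : E) (a u : nat -> E).

Lemma qnorm_le x y : vabs x <= y -> qnorm x <= qnorm y.
Proof.
by move=> xy; apply: qnorm_monotone; rewrite (le_trans xy)// ler_vabs.
Qed.

Lemma qnorm_vabs x : qnorm (vabs x) = qnorm x.
Proof.
by apply/le_anti/andP; split; apply: qnorm_monotone; rewrite vabs_id.
Qed.

Lemma qnorm_constant : exists2 C : R, 1 <= C &
  forall x y : E, qnorm (x + y) <= C * (qnorm x + qnorm y).
Proof. exact: qnormD. Qed.

Lemma qnorm_cvg_near u l (eps : R) : u @ \oo --> qnorm_nbhs (@qnorm R E) l ->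
  0 < eps -> exists n0, forall n, (n0 <= n)%N -> qnorm (u n - l) < eps.
Proof.
move=> ul eps0; have [|n0 _ nP] := ul [set y | qnorm (y - l) < eps].
  by exists eps.
by exists n0 => n n0n; exact: nP.
Qed.

(** A quasi-norm need not be continuous, so the inequality is not passed to the limit in norm: the
    positive part [w] of the excess is dominated by |u n - l|, hence has quasi-norm 0. *)
Lemma qnorm_cvg_le u l x y n0 : u @ \oo --> qnorm_nbhs (@qnorm R E) l ->
  (forall n, (n0 <= n)%N -> vabs (u n - x) <= y) -> vabs (l - x) <= y.
Proof.
move=> ul uxy; pose w := vjoin (vabs (l - x) - y) 0.
have w0 : 0 <= w by exact: vjoin_ler.
suff /qnorm_eq0 w_eq0 : qnorm w = 0.
  by rewrite -vsubr_ge0 -vlerN2 oppr0 opprB -w_eq0 vjoin_lel.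
apply: le_anti; rewrite qnorm_ge0 andbT; apply/ler_addgt0Pr => eps eps0.
have [n1 n1P] := qnorm_cvg_near ul eps0; pose n := maxn n0 n1.
rewrite add0r (le_trans _ (ltW (n1P n (leq_maxr _ _))))//.
rewrite qnorm_monotone// vabs_ge0P// vjoin_lub ?vabs_ge0//.
rewrite vlerBlDr vabsB (le_trans _ (vlerD (lexx _) (uxy n (leq_maxl _ _))))//.
rewrite (vabsB (u n) x) [leRHS]addrC (_ : x - l = (x - u n) + (u n - l)) ?vabsD//.
by rewrite addrA subrK.
Qed.

(** Tails are estimated in the order, by multiples of [y], and only then measured: the
    quasi-triangle inequality applied term by term would accumulate its constant. *)
Lemma qnorm_series a y : 0 <= y -> (forall n, vabs (a n) <= 2^-1 ^+ n *: y) ->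
  exists l, forall n, vabs (l - \sum_(k < n) a k) <= (2 * 2^-1 ^+ n) *: y.
Proof.
move=> y0 ay; pose S n := \sum_(k < n) a k.
have dist n k : vabs (S (n + k)%N - S n) <= (2 * 2^-1 ^+ n - 2 * 2^-1 ^+ (n + k)) *: y.
  elim: k => [|k IH]; first by rewrite addn0 !subrr scale0r vabs0.
  rewrite addnS /S big_ord_recr/= -/(S _) addrAC (le_trans (vabsD _ _))//.
  rewrite (le_trans (vlerD IH (ay _)))// -scalerDl; apply: vlerZr => //.
  by rewrite exprS; lra.
have p0 n : 0 <= (2^-1 : R) ^+ n by rewrite exprn_ge0.
have distle n m : (n <= m)%N -> vabs (S m - S n) <= (2 * 2^-1 ^+ n) *: y.
  move=> nm; rewrite -(subnKC nm) (le_trans (dist _ _))// vlerZr//.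
  by have := p0 (n + (m - n))%N; lra.
have [|l Sl] := @qnorm_complete R E S.
  move=> eps eps0; have q0 := @qnorm_ge0 R E y.
  have [n0 n0P] : exists n0, (2^-1 : R) ^+ n0 < eps / (4 * (qnorm y + 1)).
    have c0 : 0 < eps / (4 * (qnorm y + 1)) by rewrite divr_gt0// mulr_gt0// ltr_wpDl.
    have h2 : `|2^-1 : R| < 1 by rewrite ger0_norm; lra.
    have [n _ nP] := cvgr_lt _ (cvg_expr h2) _ c0.
    by exists n; apply: nP => /=.
  exists n0 => m n n0m n0n.
  apply: (@le_lt_trans _ _ (qnorm ((4 * 2^-1 ^+ n0) *: y))).
    apply: qnorm_le; rewrite (_ : S m - S n = (S m - S n0) + (S n0 - S n)); last first.
      by rewrite addrA subrK.
    rewrite (le_trans (vabsD _ _))// [X in _ + X]vabsB.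
    rewrite (le_trans (vlerD (distle _ _ n0m) (distle _ _ n0n)))// -scalerDl.
    by rewrite vlerZr//; lra.
  rewrite qnormZ ger0_norm ?mulr_ge0//.
  move: n0P; rewrite ltr_pdivlMr ?mulr_gt0 ?ltr_wpDl//.
  by have := p0 n0; have := mulr_ge0 (p0 n0) q0; lra.
exists l => n; apply: (qnorm_cvg_le (n0 := n) Sl) => m; exact: distle.
Qed.

End QuasiBanach.

Section Embedding.
Variables (R : realType) (E : quasiBanachLatticeType R) (V : topVectorLatticeType R).
Variable j : {linear E -> V}.
Hypothesis jP : compatible_embedding j.

Lemma emb_inj : injective j.
Proof. by case: jP. Qed.

Lemma emb_vjoin x y : j (vjoin x y) = vjoin (j x) (j y).
Proof. by case: jP => _ _ _ /(_ x y)[]. Qed.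

Lemma emb_le x y : (j x <= j y) = (x <= y).
Proof.
by rewrite -!vjoin_eqr -emb_vjoin (inj_eq emb_inj).
Qed.

Lemma emb_ge0 x : (0 <= j x) = (0 <= x).
Proof. by rewrite -(linear0 j) emb_le. Qed.

Lemma emb_vabs x : j (vabs x) = vabs (j x).
Proof. by rewrite emb_vjoin linearN. Qed.

Lemma emb_vabs_le x y : (vabs (j x) <= j y) = (vabs x <= y).
Proof. by rewrite -emb_vabs emb_le. Qed.

(** Interval preservation speaks of positive intervals, so the positive and negative parts of [w]
    are pulled back separately. *)
Lemma emb_preimage w y : vabs w <= j y -> exists2 x, w = j x & vabs x <= y.
Proof.
move=> wy; have jy0 : 0 <= j y by rewrite (le_trans (vabs_ge0 w)).
have y0 : 0 <= y by rewrite -emb_ge0.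
have pre v : 0 <= v -> v <= j y -> exists x, v = j x.
  move=> v0 vy; have jI : interval_preserving j by case: jP.
  have : [set w | 0 <= w <= j y] v by rewrite /= v0.
  by rewrite -jI// => -[x _ <-]; exists x.
have [a aE] : exists a, vjoin w 0 = j a.
  apply: pre; first exact: vjoin_ler.
  by rewrite vjoin_lub// (le_trans (ler_vabs _)).
have [b bE] : exists b, vjoin (- w) 0 = j b.
  apply: pre; first exact: vjoin_ler.
  by rewrite vjoin_lub// (le_trans (lerN_vabs _)).
have wE : w = j (a - b).
  rewrite linearB -aE -bE; apply/eqP; rewrite -subr_eq opprK; apply/eqP.
  by rewrite addrC -vjoinD addNr add0r; apply: le_anti; apply/andP; split;
    apply: vjoin_lub; rewrite ?vjoin_lel ?vjoin_ler.
by exists (a - b) => //; rewrite -emb_vabs_le -wE.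
Qed.

Lemma emb_cvg0 u : (forall eps : R, 0 < eps -> exists n0, forall n, (n0 <= n)%N ->
    qnorm (u n) < eps) -> (j \o u) @ \oo --> (0 : V).
Proof.
move=> u0; rewrite -(linear0 j); case: jP => _ jc _ _.
apply: cvg_trans (jc 0) => A /= [eps /= eps0 epsA].
have [n0 n0P] := u0 eps eps0; exists n0 => // n n0n /=.
by apply: epsA; rewrite /= subr0 n0P.
Qed.

End Embedding.

(** * Compatible pairs *)

Lemma continuous_quadrant (R : realType) (T : topologicalType)
    (psi : R -> R -> R) (f g : T -> R) :
  {within [set p : R * R | 0 <= p.1 /\ 0 <= p.2],
     continuous (fun p : R * R => psi p.1 p.2)} ->
  continuous f -> continuous g -> (forall w, 0 <= f w) -> (forall w, 0 <= g w) ->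
  continuous (fun w => psi (f w) (g w)).
Proof.
move=> /subspace_continuousP cpsi cf cg f0 g0 w.
have := cpsi (f w, g w) (conj (f0 w) (g0 w)); apply: cvg_trans => A /= Anear.
have : nbhs (f w, g w) [set p : R * R | 0 <= p.1 /\ 0 <= p.2 -> A (psi p.1 p.2)].
  exact: Anear.
move=> /(cvg_pair (cf w) (cg w)) nearA.
apply: (@filterS T (nbhs w) _ _ _ _ nearA) => w' /=; apply.
by split => /=; [exact: f0|exact: g0].
Qed.

Section Pair.
Variables (R : realType) (Y : compatiblePair R).
Local Notation j0 := (cp_emb0 Y).
Local Notation j1 := (cp_emb1 Y).
Let j0P := cp_emb0P Y.
Let j1P := cp_emb1P Y.

Lemma pair_split (x : cp_ambient Y) (c0 : cp0 Y) (c1 : cp1 Y) :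
  0 <= c0 -> 0 <= c1 -> vabs x <= j0 c0 + j1 c1 ->
  exists a b, [/\ x = j0 a + j1 b, vabs a <= c0 & vabs b <= c1].
Proof.
move=> c0_ge0 c1_ge0.
move=> /riesz_decomposition[||u uc vc]; rewrite ?(emb_ge0 j0P) ?(emb_ge0 j1P)//.
have [a uE ac] := emb_preimage j0P uc; have [b vE bc] := emb_preimage j1P vc.
by exists a, b; split => //; rewrite -uE -vE addrC subrK.
Qed.

Variables (y0 : cp0 Y) (y1 : cp1 Y).
Hypotheses (y0_ge0 : 0 <= y0) (y1_ge0 : 0 <= y1).
Let e := vjoin (j0 y0) (j1 y1).

Lemma pair_unit_ge0 : 0 <= e.
Proof. by apply: vjoin_ge0; rewrite (emb_ge0 j0P). Qed.

Lemma pair_unit_le : e <= j0 y0 + j1 y1.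
Proof. by apply: vjoin_le_add; rewrite ?(emb_ge0 j0P) ?(emb_ge0 j1P). Qed.

(** For every n, the positive part [z] of [x] is at most (y0 + y1)/n, hence a sum of parts dominated
    by y0/n and y1/n. These tend to 0 in quasi-norm, so in the ambient space; the constant sequence
    [z] then tends to 0, and the Hausdorff property gives [z = 0]. *)
Lemma pair_archimedean x : (forall n, n%:R *: x <= e) -> x <= 0.
Proof.
move=> nx; pose z := vjoin x 0; have z0 : 0 <= z by exact: vjoin_ler.
suff z_eq0 : 0 = z by rewrite z_eq0 vjoin_lel.
have n0 n : 0 < (n.+1%:R : R)^-1 by rewrite invr_gt0.
have /choice[ab abP] : forall n : nat, exists ab : cp0 Y * cp1 Y,
    [/\ z = j0 ab.1 + j1 ab.2, vabs ab.1 <= n.+1%:R^-1 *: y0 &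
        vabs ab.2 <= n.+1%:R^-1 *: y1].
  move=> n.
  have [|||a [b [zE ay by_]]] := @pair_split z (n.+1%:R^-1 *: y0) (n.+1%:R^-1 *: y1).
  - exact: vlattice_scaler_ge0 (ltW (n0 n)) _.
  - exact: vlattice_scaler_ge0 (ltW (n0 n)) _.
  - have n1 : 0 < n.+1%:R :> R by [].
    rewrite vabs_ge0P// -(vlerZ_pos _ _ n1) !linearZ/= -scalerDr scalerA.
    rewrite divff ?gt_eqF// scale1r (le_trans _ pair_unit_le)//.
    by rewrite -vjoinZ// scaler0 vjoin_lub ?nx ?pair_unit_ge0.
  by exists (a, b).
have small (q eps : R) (f : nat -> R) : 0 <= q -> (forall n, f n <= n.+1%:R^-1 * q) ->
    0 < eps -> exists m, forall n, (m <= n)%N -> f n < eps.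
  move=> q0 fq eps0; exists (Num.bound (q / eps)) => n mn.
  apply: le_lt_trans (fq n) _; rewrite mulrC ltr_pdivrMr// mulrC -ltr_pdivrMr//.
  apply: lt_le_trans (archi_boundP _) _; first by rewrite divr_ge0// ltW.
  by rewrite ler_nat (leq_trans mn).
have c0 : (j0 \o (fun n => (ab n).1)) @ \oo --> (0 : cp_ambient Y).
  apply: (emb_cvg0 j0P) => eps; apply: (small (qnorm y0)) => // [|n].
    exact: qnorm_ge0.
  have [_ h _] := abP n; apply: le_trans (qnorm_le h) _.
  by rewrite qnormZ gtr0_norm.
have c1 : (j1 \o (fun n => (ab n).2)) @ \oo --> (0 : cp_ambient Y).
  apply: (emb_cvg0 j1P) => eps; apply: (small (qnorm y1)) => // [|n].
    exact: qnorm_ge0.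
  have [_ _ h] := abP n; apply: le_trans (qnorm_le h) _.
  by rewrite qnormZ gtr0_norm.
have cz : (fun n : nat => z) @ \oo --> (0 : cp_ambient Y).
  have -> : (fun n : nat => z) = (fun p : cp_ambient Y * cp_ambient Y => p.1 + p.2)
      \o (fun n => (j0 (ab n).1, j1 (ab n).2)).
    by apply/funext => n /=; case: (abP n).
  have h := @add_continuous _ ((0, 0) : cp_ambient Y * cp_ambient Y).
  by rewrite /continuous_at /= addr0 in h; exact: cvg_comp (cvg_pair c0 c1) h.
apply: (cvg_unique (@cp_hausdorff R Y) cz); exact: cvg_cst.
Qed.

(** The increments are split between the two spaces, where both series converge with an order
    estimate of the tails. *)
Lemma pair_complete (u : nat -> cp_ambient Y) :
  (forall n, vabs (u n.+1 - u n) <= 2^-1 ^+ n *: e) ->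
  exists l, forall n, vabs (l - u n) <= (4 * 2^-1 ^+ n) *: e.
Proof.
move=> ue; have p0 n : 0 <= (2^-1 : R) ^+ n by rewrite exprn_ge0.
have /choice[ab abP] : forall n : nat, exists ab : cp0 Y * cp1 Y,
    [/\ u n.+1 - u n = j0 ab.1 + j1 ab.2, vabs ab.1 <= 2^-1 ^+ n *: y0 &
        vabs ab.2 <= 2^-1 ^+ n *: y1].
  move=> n; have [|||a [b [E ay by_]]] :=
      @pair_split (u n.+1 - u n) (2^-1 ^+ n *: y0) (2^-1 ^+ n *: y1).
  - exact: vlattice_scaler_ge0.
  - exact: vlattice_scaler_ge0.
  - rewrite !linearZ/= -scalerDr (le_trans (ue n))// vlerZl//.
    exact: pair_unit_le.
  by exists (a, b).
have [|A AP] := @qnorm_series _ _ (fun n => (ab n).1) y0 y0_ge0.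
  by move=> n; case: (abP n).
have [|B BP] := @qnorm_series _ _ (fun n => (ab n).2) y1 y1_ge0.
  by move=> n; case: (abP n).
exists (u 0%N + j0 A + j1 B) => n.
have -> : u n = u 0%N + j0 (\sum_(k < n) (ab k).1) + j1 (\sum_(k < n) (ab k).2).
  elim: n => [|n IH]; first by rewrite !big_ord0 !linear0 !addr0.
  rewrite !big_ord_recr/= !linearD/= -[LHS](subrK (u n)) {2}IH.
  case: (abP n) => -> _ _; rewrite addrC -!addrA; congr (_ + _).
  by congr (_ + _); rewrite addrCA.
have cancel (a b c b2 c2 : cp_ambient Y) :
    a + b + c - (a + b2 + c2) = (b - b2) + (c - c2).
  by rewrite -(addrA a b c) -(addrA a b2 c2) opprD addrACA subrr add0r opprD addrACA.
rewrite cancel -!linearB (le_trans (vabsD _ _))//.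
have e_ge : (2 * 2^-1 ^+ n) *: e + (2 * 2^-1 ^+ n) *: e = (4 * 2^-1 ^+ n) *: e.
  by rewrite -scalerDl; congr (_ *: _); ring.
have q0 : 0 <= 2 * 2^-1 ^+ n :> R by rewrite mulr_ge0.
rewrite -e_ge vlerD//.
  apply: (@le_trans _ _ (j0 ((2 * 2^-1 ^+ n) *: y0))).
    by rewrite (emb_vabs_le j0P).
  by rewrite linearZ/= vlerZl// vjoin_lel.
apply: (@le_trans _ _ (j1 ((2 * 2^-1 ^+ n) *: y1))).
  by rewrite (emb_vabs_le j1P).
by rewrite linearZ/= vlerZl// vjoin_ler.
Qed.

Lemma functional_calculus_exists (phi : R -> R -> R) : classP phi ->
  exists z, functional_calculus phi (j0 y0) (j1 y1) z.
Proof.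
move=> Pphi; have e0 := pair_unit_ge0.
have hP := kakutani e0 pair_archimedean pair_complete.
have I0 : principal_ideal e (j0 y0).
  by apply: principal_ideal_itv; rewrite (emb_ge0 j0P) y0_ge0 vjoin_lel.
have I1 : principal_ideal e (j1 y1).
  by apply: principal_ideal_itv; rewrite (emb_ge0 j1P) y1_ge0 vjoin_ler.
have psiP := phi_ext_extension Pphi.
have [z Iz hz] : exists2 z, principal_ideal e z & forall w : spectrum e,
    gelfand z w = phi_ext phi (gelfand (j0 y0) w) (gelfand (j1 y1) w).
  apply: (our_surj hP); apply: continuous_quadrant; first by case: psiP.
  - exact: continuous_gelfand.
  - exact: continuous_gelfand.
  - by move=> w; apply: (our_ge0 e0 hP) => //; rewrite (emb_ge0 j0P).
  - by move=> w; apply: (our_ge0 e0 hP) => //; rewrite (emb_ge0 j1P).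
exists z, (phi_ext phi), (spectrum e), (@gelfand R _ e); split => //.
split; [exact: compact_spectrum|exact: hausdorff_spectrum].
Qed.

End Pair.

Section Decomposition.
Variables (R : realType) (X : compatiblePair R) (phi : R -> R -> R).
Hypothesis Pphi : classP phi.
Local Notation j0 := (cp_emb0 X).
Local Notation j1 := (cp_emb1 X).
Local Notation psi := (phi_ext phi).

(** [vL] and [vR] carry the parts of [x] where [x1/x0] is close to [0] and to
    infinity; every other piece lies in both spaces of the pair. *)
Lemma calculus_decomposition (x0 : cp0 X) (x1 : cp1 X) (x z : cp_ambient X)
    (lambda eta : R) : 0 <= x0 -> 0 <= x1 -> 0 < lambda -> 0 < eta ->
  functional_calculus phi (j0 x0) (j1 x1) z -> vabs x <= lambda *: z ->
  exists n (alpha beta : nat -> R) (vL : cp0 X) (vR : cp1 X)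
    (v0 : nat -> cp0 X) (v1 : nat -> cp1 X),
  [/\ forall k, (k < n)%N -> [/\ 0 < alpha k, 0 < beta k & j0 (v0 k) = j1 (v1 k)],
      forall s t, 0 <= s -> 0 <= t ->
        \sum_(k < n) Num.min (alpha k * s) (beta k * t) <= 8 * psi s t,
      x = j0 vL + j1 vR + \sum_(k < n) j0 (v0 k),
      vabs vL <= (lambda * (psi 1 0 + eta)) *: x0 /\
        vabs vR <= (lambda * (psi 0 1 + eta)) *: x1 &
      \sum_(k < n) vabs ((alpha k)^-1 *: v0 k) <= (4 * lambda) *: x0 /\
        \sum_(k < n) vabs ((beta k)^-1 *: v1 k) <= (4 * lambda) *: x1].
Proof.
move=> x0_ge0 x1_ge0 l0 eta0 [psi' [K [h [psiP _ hP Iz hz]]]] xz.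
have j0P := cp_emb0P X; have j1P := cp_emb1P X.
have jx0 : 0 <= j0 x0 by rewrite (emb_ge0 j0P).
have jx1 : 0 <= j1 x1 by rewrite (emb_ge0 j1P).
set e := vjoin (j0 x0) (j1 x1) in hP Iz *.
have e0 : 0 <= e by exact: vjoin_ge0.
have Ix0 : principal_ideal e (j0 x0).
  by apply: principal_ideal_itv; rewrite jx0 vjoin_lel.
have Ix1 : principal_ideal e (j1 x1).
  by apply: principal_ideal_itv; rewrite jx1 vjoin_ler.
have IZ a y : principal_ideal e y -> principal_ideal e (a *: y).
  exact: principal_idealZ.
have Ix : principal_ideal e x.
  apply: (principal_ideal_solid (IZ lambda _ Iz)).
  by rewrite (le_trans xz)// ler_vabs.
pose s := h (j0 x0); pose t := h (j1 x1); pose y w := 1 + t w - s w.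
have s0 w : 0 <= s w by exact: (our_ge0 e0 hP).
have t0 w : 0 <= t w by exact: (our_ge0 e0 hP).
have st w : Num.max (s w) (t w) = 1 by rewrite -(our_vjoin hP)// (our_unit hP).
have hx w : `|h x w| <= lambda * psi (s w) (t w).
  rewrite -(quadrant_extension_unique Pphi psiP)// -hz -(ourZ hP)//.
  by apply: (our_vabs_le e0 hP) => //; exact: IZ.
have [n [alpha [beta [lft [rgt [mid D]]]]]] := discretization_exists Pphi eta0.
have cy : continuous y.
  have cs := our_continuous hP Ix0; have ct := our_continuous hP Ix1.
  by move=> w; exact: cvgB (cvgD (cvg_cst _) (ct w)) (cs w).
(* Cutting is multiplication by a function of [y]; the product is continuous, so it represents an
   element of the ideal. *)
have piece (g : R -> R) : continuous g -> exists2 u, principal_ideal e u &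
    forall w, h u w = g (y w) * h x w.
  move=> cg; apply: (our_surj hP) => w.
  apply: cvgM; last exact: (our_continuous hP Ix).
  exact: (continuous_comp (cy w) (cg (y w))).
have le_emb0 u c : principal_ideal e u -> (forall w, `|h u w| <= c * s w) ->
    exists2 v, u = j0 v & vabs v <= c *: x0.
  move=> Iu uc; apply: (emb_preimage j0P); rewrite linearZ/=.
  apply/(our_le e0 hP) => [||w]; [exact: principal_ideal_vabs|exact: IZ|].
  by rewrite (our_vabs e0 hP)// (ourZ hP).
have le_emb1 u c : principal_ideal e u -> (forall w, `|h u w| <= c * t w) ->
    exists2 v, u = j1 v & vabs v <= c *: x1.
  move=> Iu uc; apply: (emb_preimage j1P); rewrite linearZ/=.
  apply/(our_le e0 hP) => [||w]; [exact: principal_ideal_vabs|exact: IZ|].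
  by rewrite (our_vabs e0 hP)// (ourZ hP).
have hg g c w r : 0 <= g -> g * psi (s w) (t w) <= g * (c * r) ->
    `|g * h x w| <= g * (lambda * c * r).
  move=> g0 gc; rewrite normrM ger0_norm// (le_trans (ler_wpM2l g0 (hx w)))//.
  by have := ler_wpM2l (ltW l0) gc; lra.
have mid_sum w : \sum_(k < n) mid k (y w) <= 1.
  have := dsc_sum D (y w); have := dsc_lft_ge0 D (y w).
  by have := dsc_rgt_ge0 D (y w); lra.
have lft1 w : lft (y w) <= 1.
  have := dsc_sum D (y w); have := dsc_rgt_ge0 D (y w).
  have : 0 <= \sum_(k < n) mid k (y w).
    by apply: sumr_ge0 => k _; exact: (dsc_mid_ge0 D).
  lra.
have rgt1 w : rgt (y w) <= 1.
  have := dsc_sum D (y w); have := dsc_lft_ge0 D (y w).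
  have : 0 <= \sum_(k < n) mid k (y w).
    by apply: sumr_ge0 => k _; exact: (dsc_mid_ge0 D).
  lra.
have mid1 k w : (k < n)%N -> mid k (y w) <= 1.
  move=> kn; apply: le_trans (mid_sum w); rewrite (bigD1 (Ordinal kn))//= lerDl.
  by apply: sumr_ge0 => i _; exact: (dsc_mid_ge0 D).
have c0 : 0 <= psi 1 0 + eta.
  by have := phi_ext_ge0 Pphi ler01 (lexx 0); move: eta0; lra.
have c1 : 0 <= psi 0 1 + eta.
  by have := phi_ext_ge0 Pphi (lexx 0) ler01; move: eta0; lra.
have [uL IuL huL] := piece lft (dsc_cont_lft D).
have [uR IuR huR] := piece rgt (dsc_cont_rgt D).
have /choice[u uP] : forall k, exists u, principal_ideal e u /\
    forall w, h u w = mid k (y w) * h x w.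
  by move=> k; have [|u Iu hu] := piece (mid k); [exact: (dsc_cont_mid D)|exists u].
have [vL uLE vLle] : exists2 v, uL = j0 v & vabs v <= (lambda * (psi 1 0 + eta)) *: x0.
  apply: le_emb0 => // w; rewrite huL.
  apply: (le_trans (hg _ _ w (s w) (dsc_lft_ge0 D _) (dsc_lft_le D (s0 w) (t0 w) (st w)))).
  by apply: ler_piMl (lft1 w); rewrite !mulr_ge0// ltW.
have [vR uRE vRle] : exists2 v, uR = j1 v & vabs v <= (lambda * (psi 0 1 + eta)) *: x1.
  apply: le_emb1 => // w; rewrite huR.
  apply: (le_trans (hg _ _ w (t w) (dsc_rgt_ge0 D _) (dsc_rgt_le D (s0 w) (t0 w) (st w)))).
  by apply: ler_piMl (rgt1 w); rewrite !mulr_ge0// ltW.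
have hu0 k w : (k < n)%N ->
    `|h (u k) w| <= mid k (y w) * (lambda * (4 * alpha k) * s w).
  move=> kn; case: (uP k) => _ ->.
  by apply: hg; [exact: (dsc_mid_ge0 D)|exact: (dsc_alpha_le D)].
have hu1 k w : (k < n)%N ->
    `|h (u k) w| <= mid k (y w) * (lambda * (4 * beta k) * t w).
  move=> kn; case: (uP k) => _ ->.
  by apply: hg; [exact: (dsc_mid_ge0 D)|exact: (dsc_beta_le D)].
(* The sequences are indexed by all naturals; 0 is a default for [k >= n]. *)
have /choice[v0 v0P] : forall k, exists v, (k < n)%N -> u k = j0 v.
  move=> k; have [kn|nk] := boolP (k < n)%N; last by exists 0 => kn.
  have [|v uv _] := le_emb0 (u k) (lambda * (4 * alpha k)) (uP k).1; last by exists v.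
  move=> w; apply: le_trans (hu0 k w kn) _.
  by rewrite ler_piMl ?mid1// !mulr_ge0// ltW// (dsc_alpha_gt0 D).
have /choice[v1 v1P] : forall k, exists v, (k < n)%N -> u k = j1 v.
  move=> k; have [kn|nk] := boolP (k < n)%N; last by exists 0 => kn.
  have [|v uv _] := le_emb1 (u k) (lambda * (4 * beta k)) (uP k).1; last by exists v.
  move=> w; apply: le_trans (hu1 k w kn) _.
  by rewrite ler_piMl ?mid1// !mulr_ge0// ltW// (dsc_beta_gt0 D).
(* After division by [c k], the piece is at most [mid k] times [4 * lambda * r], and the [mid k] add
   up to at most 1: the bound does not see [n]. *)
have sum_le (c : nat -> R) (r : K -> R) : (forall k, (k < n)%N -> 0 < c k) ->
    (forall w, 0 <= r w) ->
    (forall k w, (k < n)%N -> `|h (u k) w| <= mid k (y w) * (lambda * (4 * c k) * r w)) ->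
    forall w, h (\sum_(k < n) vabs ((c k)^-1 *: u k)) w <= (4 * lambda) * r w.
  move=> c_gt0 r0 huc w; rewrite (our_sum e0 hP (f := fun k => vabs ((c k)^-1 *: u k))).
    apply: (@le_trans _ _ (\sum_(k < n) mid k (y w) * (4 * lambda * r w))).
      apply: ler_sum => k _; have ck := c_gt0 k (ltn_ord k).
      have [Iu _] := uP k; rewrite (our_vabs e0 hP) ?(ourZ hP)//; last exact: IZ.
      rewrite normrM gtr0_norm ?invr_gt0// ler_pdivrMl//.
      by rewrite (le_trans (huc k w (ltn_ord k)))// le_eqVlt; apply/orP; left;
        apply/eqP; ring.
    rewrite -mulr_suml ler_piMl// !mulr_ge0//; exact: ltW.
  by move=> k _; apply: principal_ideal_vabs; apply: IZ; case: (uP k).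
have Isum (c : nat -> R) : principal_ideal e (\sum_(k < n) vabs ((c k)^-1 *: u k)).
  apply: (principal_ideal_sum e0 (f := fun k => vabs ((c k)^-1 *: u k))) => k _.
  by apply: principal_ideal_vabs; apply: IZ; case: (uP k).
exists n, alpha, beta, vL, vR, v0, v1; split => //.
- move=> k kn; rewrite (dsc_alpha_gt0 D)// (dsc_beta_gt0 D)//; split => //.
  by rewrite -v0P// v1P.
- exact: (dsc_sum_min D).
- have -> : \sum_(k < n) j0 (v0 k) = \sum_(k < n) u k.
    by apply: eq_bigr => k _; rewrite v0P.
  have Iu : principal_ideal e (\sum_(k < n) u k).
    by apply: (principal_ideal_sum e0) => k _; case: (uP k).
  rewrite -uLE -uRE; apply: (our_inj hP) => // [|w].
    by apply: principal_idealA => //; exact: principal_idealA.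
  rewrite !(ourD hP)//; last exact: principal_idealA.
  rewrite (our_sum e0 hP); last by move=> k _; case: (uP k).
  under eq_bigr => k _ do rewrite (uP k).2.
  by rewrite huL huR -mulr_suml -!mulrDl (dsc_sum D) mul1r.
- split.
    rewrite -(emb_le j0P) linear_sum linearZ/=.
    rewrite (eq_bigr (fun k : 'I_n => vabs ((alpha k)^-1 *: u k))).
      apply/(our_le e0 hP) => // [|w]; first exact: IZ.
      rewrite (ourZ hP)//; apply: sum_le => //; exact: (dsc_alpha_gt0 D).
    by move=> k _; rewrite (emb_vabs j0P) linearZ/= -v0P.
  rewrite -(emb_le j1P) linear_sum linearZ/=.
  rewrite (eq_bigr (fun k : 'I_n => vabs ((beta k)^-1 *: u k))).
    apply/(our_le e0 hP) => // [|w]; first exact: IZ.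
    rewrite (ourZ hP)//; apply: sum_le => //; exact: (dsc_beta_gt0 D).
  by move=> k _; rewrite (emb_vabs j1P) linearZ/= -v1P.
Qed.

End Decomposition.

(** * Operators of pairs *)

Section SumSpace.
Variables (R : realType) (X : compatiblePair R).

Lemma sum_val_is_linear : linear (@sum_val R X).
Proof. exact: (linearP (\val : {linear pairSum X -> cp_ambient X})). Qed.

HB.instance Definition _ :=
  GRing.isLinear.Build R (pairSum X) (cp_ambient X) _ (@sum_val R X)
    sum_val_is_linear.

Lemma sum_val_inj : injective (@sum_val R X).
Proof. exact: val_inj. Qed.

Lemma sum_emb0_is_linear : linear (@sum_emb0 R X).
Proof. by move=> a x y; apply: sum_val_inj; rewrite linearP/= linearP. Qed.

HB.instance Definition _ :=
  GRing.isLinear.Build R (cp0 X) (pairSum X) _ (@sum_emb0 R X) sum_emb0_is_linear.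

Lemma sum_emb1_is_linear : linear (@sum_emb1 R X).
Proof. by move=> a x y; apply: sum_val_inj; rewrite linearP/= linearP. Qed.

HB.instance Definition _ :=
  GRing.isLinear.Build R (cp1 X) (pairSum X) _ (@sum_emb1 R X) sum_emb1_is_linear.

Lemma sum_emb0_inj : injective (@sum_emb0 R X).
Proof.
by move=> x y /(congr1 (@sum_val R X)); exact: (emb_inj (cp_emb0P X)).
Qed.

Lemma sum_emb1_inj : injective (@sum_emb1 R X).
Proof.
by move=> x y /(congr1 (@sum_val R X)); exact: (emb_inj (cp_emb1P X)).
Qed.

Let sum_norms (x : pairSum X) := [set r | exists x0 x1,
  x = sum_emb0 x0 + sum_emb1 x1 /\ r = qnorm x0 + qnorm x1].

Lemma sum_norms_neq0 x : sum_norms x !=set0.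
Proof.
have /asboolP[x0 [x1 xE]] := sum_valP x.
exists (qnorm x0 + qnorm x1), x0, x1; split => //.
by apply: sum_val_inj; rewrite linearD.
Qed.

Lemma sum_qnorm_le x0 x1 :
  sum_qnorm (@sum_emb0 R X x0 + sum_emb1 x1) <= qnorm x0 + qnorm x1.
Proof.
apply: ge_inf; last by exists x0, x1.
by exists 0 => _ [y0 [y1 [_ ->]]]; rewrite addr_ge0// qnorm_ge0.
Qed.

Lemma sum_qnormD : exists2 C : R, 0 < C & forall x y : pairSum X,
  sum_qnorm (x + y) <= C * (sum_qnorm x + sum_qnorm y).
Proof.
have [C0 C0_ge1 hC0] := qnorm_constant (cp0 X).
have [C1 C1_ge1 hC1] := qnorm_constant (cp1 X).
pose C := C0 + C1; have C_gt0 : 0 < C by rewrite /C; lra.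
exists C => // x y; rewrite -ler_pdivrMl//.
apply: le_inf_add; try exact: sum_norms_neq0.
move=> _ _ [x0 [x1 [-> ->]]] [y0 [y1 [-> ->]]]; rewrite ler_pdivrMl//.
rewrite addrACA -!linearD; apply: le_trans (sum_qnorm_le _ _) _.
have := hC0 x0 y0; have := hC1 x1 y1; rewrite /C.
have q0 := addr_ge0 (qnorm_ge0 x0) (qnorm_ge0 y0).
have q1 := addr_ge0 (qnorm_ge0 x1) (qnorm_ge0 y1).
have C0_ge0 : 0 <= C0 by lra.
have C1_ge0 : 0 <= C1 by lra.
have := mulr_ge0 C0_ge0 q1; have := mulr_ge0 C1_ge0 q0; lra.
Qed.

Lemma sum_qnormZ (c : R) (x : pairSum X) : 0 < c ->
  sum_qnorm (c *: x) <= c * sum_qnorm x.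
Proof.
move=> c0; apply: le_inf_mull => //; first exact: sum_norms_neq0.
move=> _ [x0 [x1 [-> ->]]]; rewrite scalerDr -!linearZ.
by rewrite (le_trans (sum_qnorm_le _ _))// !qnormZ gtr0_norm// mulrDr.
Qed.

Variable phi : R -> R -> R.

(** The infimum need not be attained, whence the 2. Since an empty infimum is 0, a bound on it
    yields nothing before one admissible [l] is known: it is [c], by which the majorants given by
    [CL_space] are rescaled into the unit balls. *)
Lemma CL_ball_bound (x : pairSum X) : CL_space phi x -> CL_qnorm phi x <= 1 ->
  exists (x0 : cp0 X) (x1 : cp1 X) (z : cp_ambient X),
    [/\ 0 <= x0 /\ qnorm x0 <= 1, 0 <= x1 /\ qnorm x1 <= 1,
        functional_calculus phi (cp_emb0 X x0) (cp_emb1 X x1) z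
      & vabs (sum_val x) <= 2 *: z].
Proof.
move=> [x0 [x1 [z [x0_ge0 x1_ge0 zE xz]]]] x1_le.
pose c := 1 + qnorm x0 + qnorm x1.
have q0 := qnorm_ge0 x0; have q1 := qnorm_ge0 x1.
have c0 : 0 < c by rewrite /c; lra.
have ci : 0 < c^-1 by rewrite invr_gt0.
have [l [l0 [y0 [y1 [y [hy0 hy1 yE xy]]]]] l2] : exists2 l : R, [set l : R | 0 < l /\
    exists (x0 : cp0 X) (x1 : cp1 X) (z : cp_ambient X),
    [/\ 0 <= x0 /\ qnorm x0 <= 1, 0 <= x1 /\ qnorm x1 <= 1,
        functional_calculus phi (cp_emb0 X x0) (cp_emb1 X x1) z
      & vabs (sum_val x) <= l *: z]] l & l < 2.
  apply: inf_lt; last by apply: le_lt_trans x1_le _; rewrite ltr1n.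
  exists c; split => //; exists (c^-1 *: x0), (c^-1 *: x1), (c^-1 *: z).
  split; last by rewrite scalerA divff ?gt_eqF// scale1r.
  - split; first exact: vlattice_scaler_ge0 (ltW ci) _.
    by rewrite qnormZ gtr0_norm// ler_pdivrMl// mulr1 /c; lra.
  - split; first exact: vlattice_scaler_ge0 (ltW ci) _.
    by rewrite qnormZ gtr0_norm// ler_pdivrMl// mulr1 /c; lra.
  - by rewrite !linearZ; exact: functional_calculus_scale.
exists y0, y1, y; split => //; apply: (le_trans xy); apply: vlerZr; last exact: ltW.
by rewrite -(vlerZ_pos _ _ l0) scaler0 (le_trans (vabs_ge0 _) xy).
Qed.

Lemma CL_ball_intro (x : pairSum X) x0 x1 z : 0 <= x0 -> qnorm x0 <= 1 ->
  0 <= x1 -> qnorm x1 <= 1 ->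
  functional_calculus phi (cp_emb0 X x0) (cp_emb1 X x1) z ->
  vabs (sum_val x) <= z -> CL_space phi x /\ CL_qnorm phi x <= 1.
Proof.
move=> x0_ge0 x0_le1 x1_ge0 x1_le1 zE xz; split; first by exists x0, x1, z.
apply: ge_inf; first by exists 0 => l [/ltW].
by split => //; exists x0, x1, z; split => //; rewrite scale1r.
Qed.

End SumSpace.

Lemma restrict_linear (R : realType) (E F : quasiBanachLatticeType R)
    (P Q : lmodType R) (i : {linear E -> P}) (k : {linear F -> Q})
    (T : {linear P -> Q}) : injective k ->
  (exists M : R, forall x, exists2 y, T (i x) = k y & qnorm y <= M * qnorm x) ->
  exists S : {linear E -> F}, (forall x, T (i x) = k (S x)) /\
    exists2 M : R, 0 <= M & forall x, qnorm (S x) <= M * qnorm x.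
Proof.
move=> kinj [M TM].
have /choice[S SP] : forall x, exists y, T (i x) = k y /\ qnorm y <= M * qnorm x.
  by move=> x; have [y ? ?] := TM x; exists y.
have Slin : linear S.
  move=> a x y; apply: kinj; rewrite linearP -(SP x).1 -(SP y).1 -(SP _).1.
  by rewrite !linearP.
pose S' : {linear E -> F} := HB.pack S (GRing.isLinear.Build R E F _ S Slin).
exists S'; split; first by move=> x; exact: (SP x).1.
exists (Num.max 0 M); first by rewrite le_max lexx.
move=> x; apply: le_trans (SP x).2 _.
by rewrite ler_wpM2r ?qnorm_ge0// le_max lexx orbT.
Qed.

Section Majorant.
Variables (R : realType) (E F : quasiBanachLatticeType R) (S : {linear E -> F}).

(** The majorant is a multiple of [|S v| \/ sup_k |S (v_k / alpha_k)|], up to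
    replacing the first join by a sum; regularity bounds its norm independently
    of the number of pieces. *)
Lemma regular_majorant (M K C D : R) (x v : E) n (w : nat -> E) (alpha : nat -> R) :
  (forall y, qnorm (S y) <= M * qnorm y) -> 0 <= M ->
  0 < K -> regular_bound S K ->
  0 <= C -> (forall y z : F, qnorm (y + z) <= C * (qnorm y + qnorm z)) ->
  C * (2 * M + 8 * K) <= D -> 0 < D ->
  qnorm x <= 1 -> vabs v <= 2 *: x ->
  (forall k, (k < n)%N -> 0 < alpha k) ->
  \sum_(k < n) vabs ((alpha k)^-1 *: w k) <= 8 *: x ->
  exists y, [/\ 0 <= y, qnorm y <= 1, vabs (D^-1 *: S v) <= y &
    forall k, (k < n)%N -> vabs (D^-1 *: S (w k)) <= alpha k *: y].
Proof.
move=> SM M0 K0 SK C0 hC CD D0 x1 vx a0 wx.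
pose f (k : 'I_n) := vabs (S ((alpha k)^-1 *: w k)).
pose y := vabs (S v) + \big[vjoin/0]_(k < n) f k.
have Di : 0 < D^-1 by rewrite invr_gt0.
have J0 : 0 <= \big[vjoin/0]_(k < n) f k.
  by elim/big_ind: _ => [//|a b a_ge0 _|k _]; [exact: vjoin_ge0|exact: vabs_ge0].
have y0 : 0 <= y by rewrite vaddr_ge0 ?vabs_ge0.
have qle (c : R) (u : E) : 0 <= c -> vabs u <= c *: x -> qnorm u <= c.
  move=> c0 ux; apply: le_trans (qnorm_le ux) _.
  by rewrite qnormZ ger0_norm// ler_piMr.
(* [2 * M] comes from |v| <= 2 x, [8 * K] from the bound [8 *: x] on the sum, and [C] from the
   single addition in [y]. *)
have qy : qnorm y <= D.
  apply: le_trans CD; apply: le_trans (hC _ _) _; rewrite ler_wpM2l// lerD//.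
    rewrite qnorm_vabs (le_trans (SM v))// mulrC ler_wpM2r//.
    exact: qle.
  apply: le_trans (SK n (fun k => (alpha k)^-1 *: w k)) _.
  rewrite [leRHS]mulrC ler_wpM2l ?(ltW K0)//; apply: qle => //.
  by rewrite vabs_ge0P//; apply: vsumr_ge0 => k; exact: vabs_ge0.
exists (D^-1 *: y); split.
- exact: vlattice_scaler_ge0 (ltW Di) _.
- by rewrite qnormZ gtr0_norm// ler_pdivrMl// mulr1.
- rewrite vabsZ gtr0_norm// vlerZ_pos// /y -[leLHS]addr0 vlerD2l//.
- move=> k kn; have ak := a0 k kn.
  have -> : S (w k) = alpha k *: S ((alpha k)^-1 *: w k).
    by rewrite linearZ/= scalerA divff ?gt_eqF// scale1r.
  rewrite !vabsZ !gtr0_norm// scalerA mulrC -scalerA vlerZ_pos// vlerZ_pos//.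
  apply: (@le_trans _ _ (\big[vjoin/0]_(k < n) f k)).
    exact: (ler_vbigjoin f (Ordinal kn)).
  by rewrite /y -[leLHS]add0r vlerD2r vabs_ge0.
Qed.

End Majorant.

Section Interpolation.
Variables (R : realType) (X Y : compatiblePair R).
Variables (T : {linear pairSum X -> pairSum Y}) (phi : R -> R -> R).
Hypotheses (KY0 : K_oo1_property (cp0 Y)) (KY1 : K_oo1_property (cp1 Y)).
Hypotheses (opT : operator_of_pairs T) (Pphi : classP phi).

Lemma bounded_K_oo1_regular (E F : quasiBanachLatticeType R) (S : {linear E -> F}) (M : R) :
  K_oo1_property F -> (forall x, qnorm (S x) <= M * qnorm x) ->
  exists2 K : R, 0 < K & regular_bound S K.
Proof.
move=> [C _ KF] SM; have [|[K K0 SK] _] := KF E S; last by exists K.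
by exists M => x _; split => //; exact: SM.
Qed.

(** [M] is chosen before [x] and [eps], so approximants for smaller and smaller [eps] stay in one
    multiple of the unit ball: this is membership in the Gagliardo completion. *)
Lemma operator_approximation : exists2 M : R, 0 < M &
  forall x, CL_space (X := X) phi x -> CL_qnorm phi x <= 1 ->
  forall eps : R, 0 < eps -> exists w, [/\ CL_space (X := Y) phi (M^-1 *: w),
    CL_qnorm phi (M^-1 *: w) <= 1 & sum_qnorm (w - T x) < eps].
Proof.
have [T0 [T0E [M0 M0_ge0 T0M]]] := restrict_linear (i := @sum_emb0 R X)
  (k := @sum_emb0 R Y) (T := T) (@sum_emb0_inj R Y) (op_bounded0 opT).
have [T1 [T1E [M1 M1_ge0 T1M]]] := restrict_linear (i := @sum_emb1 R X)
  (k := @sum_emb1 R Y) (T := T) (@sum_emb1_inj R Y) (op_bounded1 opT).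
have [K0 K0_gt0 T0K] := bounded_K_oo1_regular KY0 T0M.
have [K1 K1_gt0 T1K] := bounded_K_oo1_regular KY1 T1M.
have [C0 C0_ge1 hC0] := qnorm_constant (cp0 Y).
have [C1 C1_ge1 hC1] := qnorm_constant (cp1 Y).
have C0_ge0 : 0 <= C0 by lra.
have C1_ge0 : 0 <= C1 by lra.
have D0_ge0 : 0 <= C0 * (2 * M0 + 8 * K0) by rewrite mulr_ge0//; lra.
have D1_ge0 : 0 <= C1 * (2 * M1 + 8 * K1) by rewrite mulr_ge0//; lra.
pose D := 1 + C0 * (2 * M0 + 8 * K0) + C1 * (2 * M1 + 8 * K1).
have D_gt0 : 0 < D by rewrite /D; lra.
have D0_le : C0 * (2 * M0 + 8 * K0) <= D by rewrite /D; lra.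
have D1_le : C1 * (2 * M1 + 8 * K1) <= D by rewrite /D; lra.
clearbody D.
exists (10 * D); first by rewrite mulr_gt0.
move=> x xCL x_le1 eps eps0.
have [x0 [x1 [z [[x0_ge0 x0_le1] [x1_ge0 x1_le1] zE xz]]]] := CL_ball_bound xCL x_le1.
(* The error is [eta] times [T0 wL] and [T1 wR], of quasi-norms at most [2 * M0] and [2 * M1]; the 1
   keeps the denominator positive and the estimate strict. *)
pose eta := eps / (2 * M0 + 2 * M1 + 1).
have d0 : 0 < 2 * M0 + 2 * M1 + 1 by lra.
have eta0 : 0 < eta by rewrite divr_gt0.
have [n [alpha [beta [vL [vR [v0 [v1 [pieces sum_min xE [vLx vRx] [v0x v1x]]]]]]]]] :=
  calculus_decomposition Pphi x0_ge0 x1_ge0 (ltr0Sn R 1) eta0 zE xz.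
set c0 := phi_ext phi 1 0 in vLx; set c1 := phi_ext phi 0 1 in vRx.
have c0_ge0 : 0 <= c0 by exact: phi_ext_ge0 (ler01) (lexx 0).
have c1_ge0 : 0 <= c1 by exact: phi_ext_ge0 (lexx 0) (ler01).
have e0_gt0 : 0 < c0 + eta by rewrite ltr_wpDl.
have e1_gt0 : 0 < c1 + eta by rewrite ltr_wpDl.
(* [c0 + eta] is positive even if phi(1, 0) = 0. Dividing by it leaves the bound [2 *: x0], free of
   [eta], so [D] is free of it too. *)
pose wL := (c0 + eta)^-1 *: vL; pose wR := (c1 + eta)^-1 *: vR.
have wLx : vabs wL <= 2 *: x0.
  rewrite vabsZ gtr0_norm ?invr_gt0// -(vlerZ_pos _ _ e0_gt0) !scalerA.
  by rewrite divff ?gt_eqF// scale1r mulrC.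
have wRx : vabs wR <= 2 *: x1.
  rewrite vabsZ gtr0_norm ?invr_gt0// -(vlerZ_pos _ _ e1_gt0) !scalerA.
  by rewrite divff ?gt_eqF// scale1r mulrC.
have alpha_gt0 k : (k < n)%N -> 0 < alpha k by move=> /pieces[].
have beta_gt0 k : (k < n)%N -> 0 < beta k by move=> /pieces[].
have e4 : 4 * 2 = 8 :> R by ring.
rewrite e4 in v0x v1x.
have [y0 [y0_ge0 y0_le1 wLy v0y]] := regular_majorant T0M M0_ge0 K0_gt0 T0K C0_ge0
  hC0 D0_le D_gt0 x0_le1 wLx alpha_gt0 v0x.
have [y1 [y1_ge0 y1_le1 wRy v1y]] := regular_majorant T1M M1_ge0 K1_gt0 T1K C1_ge0
  hC1 D1_le D_gt0 x1_le1 wRx beta_gt0 v1x.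
have [zY zYE] := functional_calculus_exists y0_ge0 y1_ge0 Pphi.
have Y0P := cp_emb0P Y; have Y1P := cp_emb1P Y.
have Dinv : 0 < D^-1 by rewrite invr_gt0.
(* Each middle piece is one element of the sum, so its image under [T] lies in both spaces and
   inherits both majorants. *)
have T01 k : (k < n)%N -> cp_emb0 Y (T0 (v0 k)) = cp_emb1 Y (T1 (v1 k)).
  move=> kn; have [_ _ v01] := pieces k kn.
  have : sum_emb0 (v0 k) = sum_emb1 (v1 k) by exact: sum_val_inj.
  by move=> /(congr1 T); rewrite T0E T1E => /(congr1 (@sum_val R Y)).
(* [w] is [T x] with [c0 + eta] and [c1 + eta] lowered to [c0] and [c1] on the extreme pieces, which
   makes them comparable to phi(y0, y1). *)
pose w := sum_emb0 (c0 *: T0 wL) + sum_emb1 (c1 *: T1 wR) +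
  \sum_(k < n) sum_emb0 (T0 (v0 k)).
exists w.
suff w_le : vabs (sum_val ((10 * D)^-1 *: w)) <= zY.
  have [wCL w_le1] := CL_ball_intro y0_ge0 y0_le1 y1_ge0 y1_le1 zYE w_le.
  split => //.
  have xE' : x = sum_emb0 vL + sum_emb1 vR + \sum_(k < n) sum_emb0 (v0 k).
    by apply: sum_val_inj; rewrite !linearD linear_sum.
  have -> : w - T x = sum_emb0 (- eta *: T0 wL) + sum_emb1 (- eta *: T1 wR).
    have vLE : vL = (c0 + eta) *: wL by rewrite scalerA divff ?gt_eqF// scale1r.
    have vRE : vR = (c1 + eta) *: wR by rewrite scalerA divff ?gt_eqF// scale1r.
    have -> : T x = sum_emb0 (T0 vL) + sum_emb1 (T1 vR) +
        \sum_(k < n) sum_emb0 (T0 (v0 k)).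
      rewrite [in LHS]xE' !linearD linear_sum T0E T1E; congr (_ + _).
      by apply: eq_bigr => k _; exact: T0E.
    have err0 : c0 *: T0 wL - T0 vL = - eta *: T0 wL.
      have -> : T0 vL = (c0 + eta) *: T0 wL by rewrite {1}vLE linearZ.
      by rewrite -scalerBl; congr (_ *: _); ring.
    have err1 : c1 *: T1 wR - T1 vR = - eta *: T1 wR.
      have -> : T1 vR = (c1 + eta) *: T1 wR by rewrite {1}vRE linearZ.
      by rewrite -scalerBl; congr (_ *: _); ring.
    rewrite /w opprD addrACA subrr addr0 opprD addrACA -err0 -err1.
    by congr (_ + _); apply: sum_val_inj; rewrite !linearB.
  apply: le_lt_trans (sum_qnorm_le _ _) _; rewrite !qnormZ !normrN gtr0_norm//.
  have qL : qnorm wL <= 2.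
    apply: le_trans (qnorm_le wLx) _; rewrite qnormZ ger0_norm//.
    by rewrite ler_piMr.
  have qR : qnorm wR <= 2.
    apply: le_trans (qnorm_le wRx) _; rewrite qnormZ ger0_norm//.
    by rewrite ler_piMr.
  rewrite -mulrDr /eta mulrAC ltr_pdivrMr// ltr_pM2l//.
  have := T0M wL; have := T1M wR.
  by have := ler_wpM2l M0_ge0 qL; have := ler_wpM2l M1_ge0 qR; lra.
have ten : 0 < 10 :> R by [].
have -> : sum_val ((10 * D)^-1 *: w) = 10^-1 *: (cp_emb0 Y (D^-1 *: (c0 *: T0 wL)) +
    cp_emb1 Y (D^-1 *: (c1 *: T1 wR)) + \sum_(k < n) cp_emb0 Y (D^-1 *: T0 (v0 k))).
  rewrite linearZ/= linear_sum/= invfM -scalerA; congr (_ *: _).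
  rewrite !linearZ/= !scalerDr scaler_sumr; congr (_ + _).
  by apply: eq_bigr => k _; rewrite linearZ.
rewrite vabsZ gtr0_norm ?invr_gt0//.
rewrite -(vlerZ_pos _ _ ten) scalerA divff ?gt_eqF// scale1r.
have scale0 c u : c *: cp_emb0 Y u = cp_emb0 Y (c *: u) by rewrite linearZ.
have scale1 c u : c *: cp_emb1 Y u = cp_emb1 Y (c *: u) by rewrite linearZ.
apply: (functional_calculus_ge Pphi (q := fun k => cp_emb0 Y (D^-1 *: T0 (v0 k)))
  (alpha := alpha) (beta := beta) _ _ zYE) => //.
- by rewrite (emb_ge0 Y0P).
- by rewrite (emb_ge0 Y1P).
- rewrite scale0 (emb_vabs_le Y0P) scalerA mulrC -scalerA vabsZ ger0_norm//.
  exact: vlerZl.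
- rewrite scale1 (emb_vabs_le Y1P) scalerA mulrC -scalerA vabsZ ger0_norm//.
  exact: vlerZl.
- by move=> k kn; rewrite scale0 (emb_vabs_le Y0P) v0y.
- move=> k kn; have -> : cp_emb0 Y (D^-1 *: T0 (v0 k)) = cp_emb1 Y (D^-1 *: T1 (v1 k)).
    by rewrite !linearZ/= T01.
  by rewrite scale1 (emb_vabs_le Y1P) v1y.
Qed.

Lemma operator_CLc_ball : exists2 M : R, 0 < M &
  forall x, CLc_ball (X := X) phi x -> CLc_ball (X := Y) phi (M^-1 *: T x).
Proof.
have [M M0 approx] := operator_approximation.
have [B TB] := op_bounded opT.
have [C C0 hC] := sum_qnormD Y.
exists M => // x xball A [e /= e0 eA].
pose B' := Num.max 1 B; have B'1 : 0 < B' by rewrite lt_max ltr01.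
have Mi : 0 < M^-1 by rewrite invr_gt0.
(* Chosen so that [C * (d + d) = M * e]: one [d] for the distance from [w] to [T x'], one for
   [T (x' - x)]. *)
pose d := M * e / (2 * C).
have d0 : 0 < d by rewrite divr_gt0 ?mulr_gt0.
have [|x' [[x'CL x'1] /= x'x]] := xball [set y | sum_qnorm (y - x) < d / B'].
  by exists (d / B') => //=; exact: divr_gt0.
have [w [wCL w1 wT]] := approx x' x'CL x'1 d d0.
exists (M^-1 *: w); split => //; apply: eA => /=.
rewrite -scalerBr (le_lt_trans (sum_qnormZ _ Mi))// ltr_pdivrMl//.
rewrite -[w](subrK (T x')) -addrA -linearB (le_lt_trans (hC _ _))//.
have T_lt : sum_qnorm (T (x' - x)) < d.
  have [_ h] := TB (x' - x) I; apply: le_lt_trans h _.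
  apply: (@le_lt_trans _ _ (B' * sum_qnorm (x' - x))).
    rewrite ler_wpM2r ?le_max ?lexx ?orbT//.
    apply: lb_le_inf; first exact: sum_norms_neq0.
    by move=> _ [y0 [y1 [_ ->]]]; rewrite addr_ge0// qnorm_ge0.
  by rewrite mulrC -ltr_pdivlMr.
have -> : M * e = C * (d + d) by rewrite /d; field; rewrite gt_eqF.
by rewrite ltr_pM2l// ltrD.
Qed.

End Interpolation.

Theorem corollary5p1 (R : realType) (X Y : compatiblePair R)
    (KY0 : K_oo1_property (cp0 Y)) (KY1 : K_oo1_property (cp1 Y))
    (T : {linear pairSum X -> pairSum Y}) (opT : operator_of_pairs T)
    (phi : R -> R -> R) (Pphi : classP phi) :
  maps_boundedly T (CLc_space (X := X) phi) (CLc_qnorm (X := X) phi)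
                   (CLc_space (X := Y) phi) (CLc_qnorm (X := Y) phi).
Proof.
have [M M0 ball] := operator_CLc_ball KY0 KY1 opT Pphi.
have scale (l : R) x : 0 < l /\ CLc_ball phi (l^-1 *: x) ->
    0 < M * l /\ CLc_ball phi ((M * l)^-1 *: T x).
  move=> [l0 xl]; split; first exact: mulr_gt0.
  by have := ball _ xl; rewrite linearZ/= scalerA -invfM.
exists M => x [l l0 xl]; split.
  by have [h1 h2] := scale l x (conj l0 xl); exists (M * l).
apply: le_inf_mull => //; first by exists l.
move=> r /scale hr; apply: ge_inf => //.
by exists 0 => s [/ltW].
Qed.
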